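(* Let $f=\tfrac45$ and let $\hat\pi\colon\mathbb{R}\to\mathbb{R}$ be the function, periodic modulo $1$, defined in the context from the explicit piecewise linear function $\pi$ (for a fixed choice function $c^+$). Then $\hat\pi$ is a two-sided discontinuous, non-piecewise linear function that is extreme and a weak facet, but is not a facet.
   Context: Fix $f=\tfrac45$. Let $\mathcal{Y}$ be the set of finite-support functions $y\colon\mathbb{R}\to\mathbb{Z}_{\ge 0}$ with $\sum_{r\in\mathbb{R}} r\,y(r)\equiv f \pmod 1$ (i.e. the difference is an integer). A function $\pi\colon\mathbb{R}\to\mathbb{R}$ is a valid function if $\pi\ge 0$ and $\sum_{r\in\mathbb{R}}\pi(r)y(r)\ge 1$ for all $y\in\mathcal{Y}$. For a valid function $\pi$, let $P(\pi)=\{\,y\in\mathcal{Y} : \sum_{r}\pi(r)y(r)=1\,\}$. A valid function $\pi$ is extreme if whenever $\pi=\tfrac12(\pi^1+\pi^2)$ with $\pi^1,\pi^2$ valid, then $\pi=\pi^1=\pi^2$. It is a facet if for every valid $\pi'$ with $P(\pi)\subseteq P(\pi')$ we have $\pi'=\pi$. It is a weak facet if for every valid $\pi'$ with $P(\pi)\subseteq P(\pi')$ we have $P(\pi)=P(\pi')$. A function is piecewise linear if there is a locally finite collection of closed proper intervals covering $\mathbb{R}$, any two distinct ones intersecting at most in a common endpoint, such that the function is affine on the interior of each interval. Two-sided discontinuous means discontinuous at the origin from both sides. Definition of the function $\pi$. Let $c_1=\frac{35}{13}$, $c_2=\frac{5}{11999}$, $c_3=-5$. Below, for each $i=0,\dots,18$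 we list the breakpoint $x_i$, the value $\pi(x_i)$, the right limit $\pi(x_i^+)$, and the slope of $\pi$ on the open interval $(x_i,x_{i+1})$, where $x_{19}=\frac{371}{800}$. On $(x_i,x_{i+1})$ the function is $\pi(x)=\pi(x_i^+)+\text{slope}\cdot(x-x_i)$. - $i=0$: $x_0=0$; value $0$; right limit $\frac{101}{650}$; slope $c_3$. - $i=1$: $x_1=\frac{101}{5000}$; value $\frac{2727}{13000}$; right limit $\frac{707}{13000}$; slope $c_1$. - $i=2$: $x_2=\frac{60153}{369200}$; value and right limit $\frac{421071}{959920}$; slope $c_3$. - $i=3$: $x_3=\frac{849}{5000}$; value $-\frac{1925}{71994}\sqrt2+\frac{4851099}{11999000}$; right limit $\frac{4851099}{11999000}$; slope $c_1$. - $i=4$: $x_4=\frac{1925}{298129}\sqrt2+\frac{849}{5000}$; value and right limit $\frac{67375}{3875677}\sqrt2+\frac{4851099}{11999000}$; slope $c_3$. - $i=5$: $x_5=\frac{77}{7752}\sqrt2+\frac{849}{5000}$; value $\frac{2695}{100776}\sqrt2+\frac{4851099}{11999000}$; right limit $\frac{385}{93016248}\sqrt2+\frac{4851099}{11999000}$; slope $c_1$. - $i=6$: $x_6=\frac{19}{100}$; value $\frac{18196}{59995}$; right limit $-\frac{1925}{71994}\sqrt2+\frac{275183}{599950}$; slope $c_1$. - $i=7$: $x_7=\frac{77}{22152}\sqrt2+\frac{281986521}{1490645000}$; value and right limit $-\frac{385}{22152}\sqrt2+\frac{10467633}{22933000}$; slope $c_3$. - $i=8$: $x_8=\frac{40294}{201875}$;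 value $\frac{795836841}{1937838500}$; right limit $\frac{848837}{2099500}$; slope $c_1$. - $i=9$: $x_9=\frac{36999}{184600}$; value and right limit $\frac{975607}{2399800}$; slope $c_3$. - $i=10$: $x_{10}=\frac{77}{7752}\sqrt2+\frac{19}{100}$; value $\frac{385}{93016248}\sqrt2+\frac{18196}{59995}$; right limit $-\frac{385}{7752}\sqrt2+\frac{275183}{599950}$; slope $c_3$. - $i=11$: $x_{11}=\frac{1051}{5000}$; value $-\frac{1925}{71994}\sqrt2+\frac{4291761}{11999000}$; right limit $\frac{4291761}{11999000}$; slope $c_1$. - $i=12$: $x_{12}=\frac{1925}{298129}\sqrt2+\frac{1051}{5000}$; value and right limit $\frac{67375}{3875677}\sqrt2+\frac{4291761}{11999000}$; slope $c_3$. - $i=13$: $x_{13}=\frac{14199}{64600}$; value $\frac{50943}{167960}$; right limit $\frac{192500}{3875677}\sqrt2+\frac{240046061}{775135400}$; slope $c_3$. - $i=14$: $x_{14}=\frac{77}{7752}\sqrt2+\frac{1051}{5000}$; value $\frac{2695}{100776}\sqrt2+\frac{4291761}{11999000}$; right limit $\frac{385}{93016248}\sqrt2+\frac{4291761}{11999000}$; slope $c_1$. - $i=15$: $x_{15}=\frac{77}{22152}\sqrt2+\frac{342208579}{1490645000}$; value and right limit $-\frac{385}{22152}\sqrt2+\frac{122181831}{298129000}$; slope $c_3$. - $i=16$: $x_{16}=\frac{193799}{807500}$; value and right limit $\frac{187742}{524875}$; slope $c_1$. - $i=17$: $x_{17}=\frac{219}{800}$; value $\frac{933}{2080}$; right limit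 $\frac{51443}{147680}$; slope $c_2$. - $i=18$: $x_{18}=\frac{269}{800}$; value and right limit $\frac{683}{2080}$; slope $c_1$. This defines $\pi$ on $[0,\frac{371}{800})$, which contains $[0,\frac f2]=[0,\frac25]$. For $x\in[\frac f2,f]$, set $\pi(x)=1-\pi(f-x)$ (on the overlap $[\frac f2,\frac{371}{800})$ this agrees with the formula $\pi(x)=\frac{683}{2080}+c_1(x-\frac{269}{800})$ given by the entry $i=18$; in particular $\pi(f)=1$). On $(f,1)$ set: $\pi(x)=\frac{549}{650}+c_1(x-\frac45)$ for $\frac45<x<\frac{4101}{5000}$; $\pi(\frac{4101}{5000})=\frac{9667}{13000}$; $\pi(x)=\frac{899}{1000}+c_3(x-\frac{4101}{5000})$ for $\frac{4101}{5000}<x<\frac{4899}{5000}$; $\pi(\frac{4899}{5000})=\frac{3333}{13000}$; $\pi(x)=\frac{101}{1000}+c_1(x-\frac{4899}{5000})$ for $\frac{4899}{5000}<x<1$. Extend $\pi$ to $\mathbb{R}$ periodically modulo $1$. Definition of $\hat\pi$. Let $l=\frac{219}{800}$, $u=\frac{269}{800}$ (so $f-u=\frac{371}{800}$, $f-l=\frac{421}{800}$), $t_1=\frac{77}{7752}\sqrt2$, $t_2=\frac{77}{2584}$, $T=\mathbb{Z}t_1+\mathbb{Z}t_2$ (a dense additive subgroup of $\mathbb{R}$), and $s=\frac{19}{23998}$. The reflection $\rho(x)=l+u-x$ induces an involution of the quotient $\mathbb{R}/T$, whose set of fixed points is $$C=\bigl\{\tfrac{l+u}2+T,\ \tfrac{l+u-t_1}2+T,\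 \tfrac{l+u-t_2}2+T,\ \tfrac{l+u-(t_1+t_2)}2+T\bigr\}.$$ The remaining elements of $\mathbb{R}/T$ are paired into two-element orbits $\{\xi,\rho(\xi)\}$. Fix a choice function $c^+$ selecting one element of each such two-element orbit, and let $C^+\subset\mathbb{R}/T$ be the set of selected elements. For $x\in[0,1]$ define: - $\hat\pi(x)=\pi(x)$ if $x\notin(l,u)\cup(f-u,f-l)$, or if $x\in(l,u)$ and $x+T\in C$, or if $x\in(f-u,f-l)$ and $f-x+T\in C$; - $\hat\pi(x)=\pi(x)+s$ if $x\in(l,u)$ and $x+T\in C^+$, or if $x\in(f-u,f-l)$ and $f-x+T\in C^+$; - $\hat\pi(x)=\pi(x)-s$ otherwise. Extend $\hat\pi$ to $\mathbb{R}$ periodically modulo $1$.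
   Formalization: The sign of the shift on (f−u,f−l) is corrected: there π̂(x)=π(x)−s if f−x+T∈C⁺, and π(x)+s if f−x+T is in neither C nor C⁺; as printed, π̂(x)+π̂(f−x)=1−2s<1 for unselected non-fixed classes x+T with x∈(l,u), so π̂ would not be valid. *)

(* Defs.v *)
From Stdlib Require Import Reals ZArith List ClassicalEpsilon.
From Coquelicot Require Import Coquelicot.
Import ListNotations.
Open Scope R_scope.

Definition f : R := 4 / 5.

(** * Valid functions *)

Definition enumerates_support (y : R -> nat) (supp : list R) : Prop :=
  NoDup supp /\ forall r, In r supp <-> y r <> 0%nat.

Definition finite_support (y : R -> nat) : Prop :=
  exists supp, enumerates_support y supp.

(* Unspecified when [y] does not have finite support. *)
Definition support (y : R -> nat) : list R :=
  epsilon (inhabits []) (enumerates_support y).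

(* sum_{r in R} g(r) y(r) *)
Definition weighted_sum (g : R -> R) (y : R -> nat) : R :=
  fold_right Rplus 0 (map (fun r => g r * INR (y r)) (support y)).

Definition feasible (y : R -> nat) : Prop :=
  finite_support y /\
  exists k : Z, weighted_sum (fun r => r) y - f = IZR k.

Definition valid (g : R -> R) : Prop :=
  (forall x, 0 <= g x) /\ (forall y, feasible y -> 1 <= weighted_sum g y).

Definition tight (g : R -> R) (y : R -> nat) : Prop :=
  feasible y /\ weighted_sum g y = 1.

Definition extreme (g : R -> R) : Prop :=
  valid g /\
  forall g1 g2, valid g1 -> valid g2 ->
    (forall x, g x = / 2 * (g1 x + g2 x)) ->
    (forall x, g x = g1 x) /\ (forall x, g x = g2 x).

Definition facet (g : R -> R) : Prop :=
  valid g /\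
  forall g', valid g' -> (forall y, tight g y -> tight g' y) ->
    forall x, g' x = g x.

Definition weak_facet (g : R -> R) : Prop :=
  valid g /\
  forall g', valid g' -> (forall y, tight g y -> tight g' y) ->
    forall y, tight g y <-> tight g' y.

(** * Piecewise linearity and discontinuity *)

(* A pair [(a, b)] with [a < b] in [Rbar] stands for the nondegenerate closed
   interval [{x | a <= x <= b}] of the real line, possibly unbounded. *)
Definition interval : Type := (Rbar * Rbar)%type.

Definition proper (I : interval) : Prop := Rbar_lt (fst I) (snd I).

Definition in_closed (I : interval) (x : R) : Prop :=
  Rbar_le (fst I) x /\ Rbar_le x (snd I).

Definition in_interior (I : interval) (x : R) : Prop :=
  Rbar_lt (fst I) x /\ Rbar_lt x (snd I).

Definition is_endpoint (I : interval) (x : R) : Prop :=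
  fst I = Finite x \/ snd I = Finite x.

Definition locally_finite (P : interval -> Prop) : Prop :=
  forall x : R, exists (eps : posreal) (Is : list interval),
    forall I, P I -> (exists y, Rabs (y - x) < eps /\ in_closed I y) -> In I Is.

Definition affine_on (g : R -> R) (A : R -> Prop) : Prop :=
  exists m q : R, forall x, A x -> g x = m * x + q.

Definition piecewise_linear (g : R -> R) : Prop :=
  exists P : interval -> Prop,
    (forall I, P I -> proper I) /\
    locally_finite P /\
    (forall x, exists I, P I /\ in_closed I x) /\
    (forall I J, P I -> P J -> I <> J ->
       forall x, in_closed I x -> in_closed J x ->
         is_endpoint I x /\ is_endpoint J x) /\
    (forall I, P I -> affine_on g (in_interior I)).

Definition two_sided_discontinuous (g : R -> R) : Prop :=
  ~ filterlim g (at_left 0) (locally (g 0)) /\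
  ~ filterlim g (at_right 0) (locally (g 0)).

(** * The piecewise linear function [pi] *)

(* Breakpoint, value there, right limit there, slope to its right. *)
Record entry : Type := Entry { bkpt : R; value : R; rlim : R; slope : R }.

Definition eval_entry (e : entry) (x : R) : R :=
  if Req_dec_T x (bkpt e) then value e else rlim e + slope e * (x - bkpt e).

(* Evaluates the last entry whose breakpoint is [<= x]; the breakpoints of
   [e :: es] are increasing and [bkpt e <= x]. *)
Fixpoint eval_table (e : entry) (es : list entry) (x : R) : R :=
  match es with
  | [] => eval_entry e x
  | e' :: es' =>
      if Rlt_dec x (bkpt e') then eval_entry e x else eval_table e' es' x
  end.

Definition c1 : R := 35 / 13.
Definition c2 : R := 5 / 11999.
Definition c3 : R := -5.

(* An entry at which the function is right continuous. *)
Definition rc_entry (x v m : R) : entry := Entry x v v m.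

Definition pi_lower : R -> R := eval_table
  (Entry 0 0 (101 / 650) c3)
  [ Entry (101 / 5000) (2727 / 13000) (707 / 13000) c1;
    rc_entry (60153 / 369200) (421071 / 959920) c3;
    Entry (849 / 5000)
      (- (1925 / 71994) * sqrt 2 + 4851099 / 11999000)
      (4851099 / 11999000) c1;
    rc_entry (1925 / 298129 * sqrt 2 + 849 / 5000)
      (67375 / 3875677 * sqrt 2 + 4851099 / 11999000) c3;
    Entry (77 / 7752 * sqrt 2 + 849 / 5000)
      (2695 / 100776 * sqrt 2 + 4851099 / 11999000)
      (385 / 93016248 * sqrt 2 + 4851099 / 11999000) c1;
    Entry (19 / 100)
      (18196 / 59995)
      (- (1925 / 71994) * sqrt 2 + 275183 / 599950) c1;
    rc_entry (77 / 22152 * sqrt 2 + 281986521 / 1490645000)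
      (- (385 / 22152) * sqrt 2 + 10467633 / 22933000) c3;
    Entry (40294 / 201875)
      (795836841 / 1937838500)
      (848837 / 2099500) c1;
    rc_entry (36999 / 184600) (975607 / 2399800) c3;
    Entry (77 / 7752 * sqrt 2 + 19 / 100)
      (385 / 93016248 * sqrt 2 + 18196 / 59995)
      (- (385 / 7752) * sqrt 2 + 275183 / 599950) c3;
    Entry (1051 / 5000)
      (- (1925 / 71994) * sqrt 2 + 4291761 / 11999000)
      (4291761 / 11999000) c1;
    rc_entry (1925 / 298129 * sqrt 2 + 1051 / 5000)
      (67375 / 3875677 * sqrt 2 + 4291761 / 11999000) c3;
    Entry (14199 / 64600)
      (50943 / 167960)
      (192500 / 3875677 * sqrt 2 + 240046061 / 775135400) c3;
    Entry (77 / 7752 * sqrt 2 + 1051 / 5000)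
      (2695 / 100776 * sqrt 2 + 4291761 / 11999000)
      (385 / 93016248 * sqrt 2 + 4291761 / 11999000) c1;
    rc_entry (77 / 22152 * sqrt 2 + 342208579 / 1490645000)
      (- (385 / 22152) * sqrt 2 + 122181831 / 298129000) c3;
    rc_entry (193799 / 807500) (187742 / 524875) c1;
    Entry (219 / 800) (933 / 2080) (51443 / 147680) c2;
    rc_entry (269 / 800) (683 / 2080) c1 ].

(* The value 1 at [f] agrees with [1 - pi_lower (f - f)]. *)
Definition pi_upper : R -> R := eval_table
  (Entry f 1 (549 / 650) c1)
  [ Entry (4101 / 5000) (9667 / 13000) (899 / 1000) c3;
    Entry (4899 / 5000) (3333 / 13000) (101 / 1000) c1 ].

Definition pi_unit (x : R) : R :=
  if Rle_dec x (f / 2) then pi_lower x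
  else if Rle_dec x f then 1 - pi_lower (f - x)
  else pi_upper x.

Definition pi (x : R) : R := pi_unit (frac_part x).

(** * The function [pi_hat] *)

Definition l : R := 219 / 800.
Definition u : R := 269 / 800.
Definition t1 : R := 77 / 7752 * sqrt 2.
Definition t2 : R := 77 / 2584.
Definition s : R := 19 / 23998.

Definition T (x : R) : Prop := exists a b : Z, x = IZR a * t1 + IZR b * t2.

(* Elements of the quotient R/T are represented as subsets of R. *)
Definition coset (x : R) : R -> Prop := fun z => T (z - x).

Definition rho (x : R) : R := l + u - x.

Definition rho_coset (xi : R -> Prop) : R -> Prop :=
  fun z => exists x, xi x /\ z = rho x.

Definition fixed_coset (xi : R -> Prop) : Prop :=
  xi = coset ((l + u) / 2) \/
  xi = coset ((l + u - t1) / 2) \/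
  xi = coset ((l + u - t2) / 2) \/
  xi = coset ((l + u - (t1 + t2)) / 2).

Definition orbit (xi : R -> Prop) : (R -> Prop) -> Prop :=
  fun zeta => zeta = xi \/ zeta = rho_coset xi.

Definition two_element_orbit (O : (R -> Prop) -> Prop) : Prop :=
  exists x, ~ fixed_coset (coset x) /\ O = orbit (coset x).

Definition choice_function (cp : ((R -> Prop) -> Prop) -> (R -> Prop)) : Prop :=
  forall O, two_element_orbit O -> O (cp O).

Definition selected (cp : ((R -> Prop) -> Prop) -> (R -> Prop))
    (xi : R -> Prop) : Prop :=
  exists O, two_element_orbit O /\ xi = cp O.

Definition unselected (cp : ((R -> Prop) -> Prop) -> (R -> Prop))
    (xi : R -> Prop) : Prop :=
  ~ fixed_coset xi /\ ~ selected cp xi.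

Definition in_special_intervals (x : R) : Prop :=
  l < x < u \/ f - u < x < f - l.

Definition special_fixed (x : R) : Prop :=
  (l < x < u /\ fixed_coset (coset x)) \/
  (f - u < x < f - l /\ fixed_coset (coset (f - x))).

(* On the mirror interval [(f - u, f - l)] the shift is by [+ s] when the class
   of [f - x] is NOT selected: this is the only sign for which
   [pi_hat x + pi_hat (f - x) = 1].  With the same sign on both intervals
   (shift by [+ s] when the class of [f - x] is selected), any [x] in [(l, u)]
   of unselected nonfixed class would give
   [pi_hat x + pi_hat (f - x) = 1 - 2 * s < 1], so [pi_hat] would not be valid. *)
Definition special_plus (cp : ((R -> Prop) -> Prop) -> (R -> Prop)) (x : R) : Prop :=
  (l < x < u /\ selected cp (coset x)) \/
  (f - u < x < f - l /\ unselected cp (coset (f - x))).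

Definition pi_hat_unit (cp : ((R -> Prop) -> Prop) -> (R -> Prop)) (x : R) : R :=
  if excluded_middle_informative
       (~ in_special_intervals x \/ special_fixed x)
  then pi x
  else if excluded_middle_informative (special_plus cp x)
  then pi x + s
  else pi x - s.

Definition pi_hat (cp : ((R -> Prop) -> Prop) -> (R -> Prop)) (x : R) : R :=
  pi_hat_unit cp (frac_part x).

(* Main.v *)
From Stdlib Require Import Reals ZArith QArith Qreals List Bool Lia Lra Permutation.
From Stdlib Require Import Classical ClassicalEpsilon.
From Stdlib Require Import FunctionalExtensionality PropExtensionality.
From Coquelicot Require Import Coquelicot.
Require Import Defs.
Import ListNotations.
Open Scope R_scope.
Set Bullet Behavior "Strict Subproofs".

(** Write [T] for the dense group generated by [t1] and [t2].  The proof describes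
    all valid functions that are tight wherever [pi] is: they are the functions
    [perturbed p], equal to [pi] except on [(l, u)], where some [p] with
    [Rabs p <= s] is added, and on the mirror interval [(f - u, f - l)], where
    [p (f - x)] is subtracted; here [p] is odd under the reflections
    [x |-> l + u - t - x] with [t = 0, t1, t2], hence invariant under [T].  All of
    these functions have the same tight sets.  The function [pi_hat] is the one in
    which [p] takes only the extreme values [s] and [- s], apart from the fixed
    classes, where oddness forces [p = 0].  It is therefore extreme; it is a weak
    facet because the tight sets agree; and it is not a facet because [p = 0] gives
    another function, [pi] itself.

    Validity ([perturbed_valid]) and equality of tight sets ([perturbed_tight]).
    For functions with [g 0 = 0] and [g x + g (f - x) = 1], validity amounts to
    [1 <= g x + g y + g z] whenever [x + y + z] is congruent to [f] modulo 1, and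
    the tight sets are determined by the triples with equality.  The eighty
    breakpoints and open intervals of [[0, 1)] cut the set of triples into
    polygons on which [pi x + pi y + pi z] is affine.  A computation in integers
    [a + b * sqrt 2] ([check_triples_faces]) bounds each of these by linear
    programming duality.  On every polygon either the perturbation terms cancel, or
    the sum for [pi] strictly exceeds [1] by more than these terms can take away
    ([dichotomy]).

    Conversely ([perturbed_of_tight]), let [g] be valid and tight wherever [pi] is.
    Then [phi = g - pi] is bounded, odd under [x |-> f - x] and additive where [pi]
    is.  On two intervals additivity is Cauchy's equation on a triangle, whose
    bounded solutions are linear ([cauchy_triangle]); a short chain of additive
    triples forces both slopes to vanish ([td_seeds]), and the value [0] then
    propagates through further additive triples to everything outside the two
    special intervals ([td_zero_on]).  On [(l, u)] the only additivities left are
    the three reflections ([td_antisymmetric]).  The bound [s] comes from a point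
    where a limit of the three-term sum of [pi] is [1 + s] ([td_ge]): the limit is
    not attained, so it yields no tight set, but by density of [T] every class
    comes close to it.  This is why [pi_hat] is extreme without being a facet. *)

(** * Validity and tightness in terms of lists *)

Definition lsum (L : list R) : R := fold_right Rplus 0 L.

Lemma lsum_app : forall L M, lsum (L ++ M) = lsum L + lsum M.
Proof. induction L; simpl; intros; [lra | rewrite IHL; lra]. Qed.

Lemma lsum_permutation : forall L M, Permutation L M -> lsum L = lsum M.
Proof. induction 1; simpl; lra. Qed.

Lemma enumerates_support_unique : forall y S S',
  enumerates_support y S -> enumerates_support y S' -> Permutation S S'.
Proof.
  intros y S S' [HS HS2] [HS' HS'2].
  apply NoDup_Permutation; auto. intros x. rewrite HS2, HS'2. tauto.
Qed.

Lemma weighted_sum_enumeration : forall g y S,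
  enumerates_support y S ->
  weighted_sum g y = lsum (map (fun r => g r * INR (y r)) S).
Proof.
  intros g y S HS. unfold weighted_sum. apply lsum_permutation.
  apply Permutation_map, (enumerates_support_unique y); auto.
  unfold support. apply epsilon_spec. now exists S.
Qed.

Lemma lsum_map_repeat : forall (g : R -> R) r n,
  lsum (map g (repeat r n)) = g r * INR n.
Proof.
  induction n; [simpl; ring |].
  rewrite S_INR. cbn [repeat map lsum fold_right].
  fold (lsum (map g (repeat r n))). rewrite IHn. ring.
Qed.

(** Functions with finite support are finite multisets of reals, and lists are
    easier to sum over and to do induction on. *)
Lemma finite_support_as_list : forall y, finite_support y ->
  exists L, forall g, weighted_sum g y = lsum (map g L).
Proof.
  intros y [S HS].
  exists (flat_map (fun r => repeat r (y r)) S). intros g.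
  rewrite (weighted_sum_enumeration g y S HS).
  clear HS. induction S as [|r S IH]; simpl; [reflexivity |].
  rewrite map_app, lsum_app, lsum_map_repeat, IH. reflexivity.
Qed.

Lemma lsum_count_occ : forall (g : R -> R) L S,
  NoDup S -> incl L S ->
  lsum (map (fun r => g r * INR (count_occ Req_dec_T L r)) S) = lsum (map g L).
Proof.
  intros g L S HS. induction L as [|a L IH]; intros Hincl.
  - simpl. clear. induction S; simpl in *; lra.
  - simpl. rewrite <- IH by (intros x Hx; apply Hincl; now right).
    assert (Ha : In a S) by (apply Hincl; now left).
    clear IH Hincl. induction S as [|b S IH]; [easy |].
    apply NoDup_cons_iff in HS as [Hb HS].
    cbn [map lsum fold_right]. destruct (Req_dec_T a b) as [<-|Hne].
    + rewrite S_INR.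
      replace (fold_right Rplus 0 (map (fun r => g r * INR
        (if Req_dec_T a r then Datatypes.S (count_occ Req_dec_T L r)
         else count_occ Req_dec_T L r)) S))
        with (fold_right Rplus 0
                (map (fun r => g r * INR (count_occ Req_dec_T L r)) S)).
      { ring. }
      f_equal. apply map_ext_in. intros r Hr.
      destruct (Req_dec_T a r); [congruence | reflexivity].
    + destruct Ha as [->|Ha]; [easy |].
      specialize (IH HS Ha). unfold lsum in IH. rewrite IH. ring.
Qed.

Lemma list_as_finite_support : forall L,
  exists y, finite_support y /\ forall g, weighted_sum g y = lsum (map g L).
Proof.
  intros L. exists (count_occ Req_dec_T L).
  assert (HS : enumerates_support (count_occ Req_dec_T L) (nodup Req_dec_T L)).
  { split; [apply NoDup_nodup |]. intros r. rewrite nodup_In.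
    rewrite (count_occ_In Req_dec_T). lia. }
  split; [now exists (nodup Req_dec_T L) |]. intros g.
  rewrite (weighted_sum_enumeration g _ _ HS).
  apply lsum_count_occ; [apply NoDup_nodup |].
  intros x Hx. now apply nodup_In.
Qed.

Definition congr_f (x : R) : Prop := exists k : Z, x = f + IZR k.

Lemma valid_on_lists : forall g, valid g <->
  (forall x, 0 <= g x) /\ (forall L, congr_f (lsum L) -> 1 <= lsum (map g L)).
Proof.
  intros g. split; intros [H0 H1]; split; auto.
  - intros L [k Hk]. destruct (list_as_finite_support L) as [y [Hy HyL]].
    rewrite <- HyL. apply H1. split; [exact Hy |].
    exists k. rewrite HyL, map_id. lra.
  - intros y [Hy [k Hk]]. destruct (finite_support_as_list y Hy) as [L HL].
    rewrite HL. apply H1. exists k.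
    rewrite HL, map_id in Hk. lra.
Qed.

Lemma tight_on_lists : forall g g',
  (forall y, tight g y -> tight g' y) <->
  (forall L, congr_f (lsum L) -> lsum (map g L) = 1 -> lsum (map g' L) = 1).
Proof.
  intros g g'. split.
  - intros H L [k Hk] HL. destruct (list_as_finite_support L) as [y [Hy HyL]].
    rewrite <- HyL. apply H. split; [split; [exact Hy|] |].
    + exists k. rewrite HyL, map_id. lra.
    + now rewrite HyL.
  - intros H y [[Hy [k Hk]] Ht]. split; [split; [exact Hy | now exists k] |].
    destruct (finite_support_as_list y Hy) as [L HL].
    rewrite HL in *. apply H; auto. exists k. rewrite map_id in Hk. lra.
Qed.

(** * Minimal functions *)

(** The part of minimality used here, in the symmetric form given by
    substituting [z = f - x - y]. *)
Definition three_term (g : R -> R) : Prop :=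
  forall x y z, congr_f (x + y + z) -> 1 <= g x + g y + g z.

Definition symmetric (g : R -> R) : Prop :=
  forall x y, congr_f (x + y) -> g x + g y = 1.

Lemma subadditive_of_three_term : forall g, symmetric g -> three_term g ->
  forall x y, g (x + y) <= g x + g y.
Proof.
  intros g Hs Ht x y.
  assert (H1 := Hs (x + y) (f - (x + y)) ltac:(exists 0%Z; simpl; lra)).
  assert (H2 := Ht x y (f - (x + y)) ltac:(exists 0%Z; simpl; lra)).
  lra.
Qed.

Lemma subadditive_lsum : forall g, g 0 = 0 ->
  (forall x y, g (x + y) <= g x + g y) ->
  forall L, g (lsum L) <= lsum (map g L).
Proof.
  intros g H0 Hs L. induction L as [|a L IH]; simpl; [lra |].
  fold (lsum L). specialize (Hs a (lsum L)). unfold lsum in *. lra.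
Qed.

Lemma symmetric_at_congr_f : forall g, g 0 = 0 -> symmetric g ->
  forall x, congr_f x -> g x = 1.
Proof.
  intros g H0 Hs x Hx. assert (H := Hs 0 x). rewrite Rplus_0_l in H.
  specialize (H Hx). lra.
Qed.

Lemma valid_of_three_term : forall g,
  (forall x, 0 <= g x) -> g 0 = 0 -> symmetric g -> three_term g -> valid g.
Proof.
  intros g Hp H0 Hs Ht. apply valid_on_lists. split; [exact Hp |].
  intros L HL. rewrite <- (symmetric_at_congr_f g H0 Hs _ HL).
  apply subadditive_lsum; auto using subadditive_of_three_term.
Qed.

(** If a sum of values attains the lower bound given by subadditivity, then so
    does each partial sum, and each partial sum is a tight triple with the
    complement [f - x - y]; so tight triples decide tightness of all lists. *)
Lemma tight_of_tight_triples : forall g h,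
  g 0 = 0 -> h 0 = 0 -> symmetric g -> symmetric h -> three_term g ->
  (forall x y z, congr_f (x + y + z) ->
     g x + g y + g z = 1 -> h x + h y + h z = 1) ->
  forall y, tight g y -> tight h y.
Proof.
  intros g h Hg0 Hh0 Hgs Hhs Hg Hgh. apply tight_on_lists.
  assert (Hsub := subadditive_of_three_term g Hgs Hg).
  assert (Hadd : forall L, lsum (map g L) = g (lsum L) ->
                           lsum (map h L) = h (lsum L)).
  { induction L as [|a L IH]; simpl; intros HL; [lra |].
    fold (lsum L) in *. fold (lsum (map g L)) in HL. fold (lsum (map h L)).
    assert (H1 := subadditive_lsum g Hg0 Hsub L).
    assert (H2 := Hsub a (lsum L)).
    rewrite IH by lra.
    assert (C2 : congr_f (a + lsum L + (f - (a + lsum L))))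
      by (exists 0%Z; simpl; lra).
    assert (C1 : congr_f ((a + lsum L) + (f - (a + lsum L))))
      by (exists 0%Z; simpl; lra).
    assert (H3 := Hgs _ _ C1). assert (H4 := Hhs _ _ C1).
    assert (H5 := Hgh _ _ _ C2). lra. }
  intros L HL H1. rewrite Hadd.
  - now apply symmetric_at_congr_f.
  - rewrite H1. symmetry. now apply symmetric_at_congr_f.
Qed.

Lemma symmetric_of_tight : forall g h, symmetric g ->
  (forall y, tight g y -> tight h y) -> symmetric h.
Proof.
  intros g h Hs Ht x y Hxy.
  assert (H := proj1 (tight_on_lists g h) Ht [x; y]).
  simpl in H. rewrite !Rplus_0_r in H. apply H; [exact Hxy | now apply Hs].
Qed.

Lemma tight_triple : forall g h,
  (forall y, tight g y -> tight h y) ->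
  forall x y z, congr_f (x + y + z) ->
  g x + g y + g z = 1 -> h x + h y + h z = 1.
Proof.
  intros g h Ht x y z Hxyz Hg.
  assert (H := proj1 (tight_on_lists g h) Ht [x; y; z]).
  simpl in H. rewrite !Rplus_0_r, <- !Rplus_assoc in H. now apply H.
Qed.

Lemma three_term_of_valid : forall g, valid g -> three_term g.
Proof.
  intros g Hg x y z Hxyz. apply valid_on_lists in Hg as [_ Hg].
  specialize (Hg [x; y; z]).
  simpl in Hg. rewrite !Rplus_0_r, <- !Rplus_assoc in Hg. now apply Hg.
Qed.

(** * Bounded solutions of Cauchy's equation on a triangle *)

Lemma additive_multiple : forall (H : R -> R) d,
  (forall x y, 0 <= x -> 0 <= y -> x + y < d -> H (x + y) = H x + H y) ->
  forall n r, 0 <= r -> INR n * r < d -> (0 < n)%nat -> H (INR n * r) = INR n * H r.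
Proof.
  intros H d Hadd n r Hr. induction n as [|n IH]; [lia |].
  intros Hn Hpos. destruct n as [|n].
  - simpl. now rewrite !Rmult_1_l.
  - assert (Hn0 : 0 <= INR (S n)) by apply pos_INR.
    rewrite (S_INR (S n)) in Hn |- *.
    rewrite !Rmult_plus_distr_r, !Rmult_1_l in *.
    rewrite Hadd by nra. rewrite IH by (lra || lia). lra.
Qed.

(** Comparing [r] with the multiples of [e / n] pins [H r] down up to
    [O (1 / n)], because boundedness forces [H] to be [O (1 / n)] on
    [[0, e / n]]. *)
Lemma additive_bounded_linear : forall (H : R -> R) d e C,
  0 < e < d ->
  (forall x y, 0 <= x -> 0 <= y -> x + y < d -> H (x + y) = H x + H y) ->
  (forall x, 0 <= x < d -> Rabs (H x) <= C) ->
  forall r, 0 <= r <= e -> H r = H e / e * r.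
Proof.
  intros H d e C He Hadd Hb r Hr.
  assert (H0 : H 0 = 0).
  { assert (E := Hadd 0 0 ltac:(lra) ltac:(lra) ltac:(lra)).
    rewrite Rplus_0_l in E. lra. }
  assert (HC : 0 <= C).
  { apply Rle_trans with (Rabs (H 0)); [apply Rabs_pos | apply Hb; lra]. }
  assert (Hsmall : forall n x, (0 < n)%nat -> 0 <= x -> INR n * x <= e ->
    Rabs (H x) <= C / INR n).
  { intros n x Hn Hx Hnx. assert (0 < INR n) by now apply lt_0_INR.
    apply Rmult_le_reg_l with (INR n); [lra |].
    replace (INR n * (C / INR n)) with C by (field; lra).
    rewrite <- (Rabs_right (INR n)) at 1 by lra. rewrite <- Rabs_mult.
    rewrite <- (additive_multiple H d); auto; [| nra].
    apply Hb. split; [nra | lra]. }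
  (* write [r = k w + q] with [w = e / n] and [0 <= q < w]; then
     [H r - (H e / e) r = H q - H w (q / w)] *)
  assert (Hn : forall n, (0 < n)%nat ->
    Rabs (H r - H e / e * r) <= 2 * C / INR n).
  { intros n Hn. assert (Hn0 : 0 < INR n) by now apply lt_0_INR.
    set (w := e / INR n).
    assert (Hw : INR n * w = e) by (unfold w; field; lra).
    assert (Hw0 : 0 < w) by (unfold w; apply Rdiv_lt_0_compat; lra).
    destruct (nfloor_ex (r / w)) as [k Hk].
    { apply Rle_div_r; lra. }
    set (q := r - INR k * w).
    assert (Hrw : r / w * w = r) by (field; lra).
    assert (Hq : 0 <= q < w) by (unfold q; nra).
    assert (HHw : INR n * H w = H e).
    { rewrite <- (additive_multiple H d), Hw; auto; lra. }
    assert (HHr : H r = INR k * H w + H q).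
    { replace r with (INR k * w + q) at 1 by (unfold q; ring).
      assert (0 <= INR k) by apply pos_INR.
      rewrite Hadd; [| nra | lra | unfold q; lra].
      destruct k as [|k]; [simpl; rewrite !Rmult_0_l, H0; lra |].
      rewrite (additive_multiple H d Hadd);
        [lra | lra | unfold q in Hq; lra | lia]. }
    replace (H r - H e / e * r) with (H q - H w * (q / w)).
    2:{ rewrite HHr. unfold q. rewrite <- HHw. rewrite <- Hw. field. lra. }
    assert (Hqw : 0 <= q / w <= 1).
    { split; [apply Rle_div_r; lra |].
      apply Rle_div_l; lra. }
    assert (B1 := Hsmall n q Hn ltac:(lra) ltac:(nra)).
    assert (B2 := Hsmall n w Hn ltac:(lra) ltac:(lra)).
    apply Rle_trans with (Rabs (H q) + Rabs (- (H w * (q / w))));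
      [apply Rabs_triang |].
    rewrite Rabs_Ropp, Rabs_mult, (Rabs_right (q / w)) by lra.
    assert (0 <= Rabs (H w)) by apply Rabs_pos.
    replace (2 * C / INR n) with (C / INR n + C / INR n) by (field; lra). nra. }
  apply Rminus_diag_uniq. destruct (Req_dec (H r - H e / e * r) 0) as [E|E]; auto.
  exfalso. apply Rabs_pos_lt in E. set (t := Rabs (H r - H e / e * r)) in *.
  destruct (nfloor_ex (2 * C / t)) as [n Hn'].
  { apply Rle_div_r; lra. }
  specialize (Hn (S n) ltac:(lia)). rewrite S_INR in Hn.
  assert (0 <= INR n) by apply pos_INR.
  apply Rle_div_r in Hn; [| lra].
  assert (2 * C < t * (INR n + 1)); [| lra].
  rewrite (Rmult_comm t). apply Rlt_div_l; lra.
Qed.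

(** The interval lemma of Gomory and Johnson for a bounded function.  Around a
    base point [c] the function [r |-> h (c + r) - h c] is additive, because
    [h (2 c + x + y)] splits in two ways; this gives an affine [h] on
    [[c, b - c)], and adding [c] once more extends it to all of [[c, b)]. *)
Lemma cauchy_triangle : forall (h : R -> R) a b C,
  0 <= a -> 3 * a < b ->
  (forall x, a < x < b -> Rabs (h x) <= C) ->
  (forall x y, a < x -> a < y -> x + y < b -> h (x + y) = h x + h y) ->
  exists m, forall x, a < x < b -> h x = m * x.
Proof.
  intros h a b C Ha Hab Hb Hadd.
  assert (Hc : forall c, a < c -> 3 * c < b ->
    exists m, forall x, c <= x < b -> h x = m * x).
  { intros c Hac Hcb. set (d := b - 2 * c).
    assert (HD : forall x y, 0 <= x -> 0 <= y -> x + y < d ->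
      h (c + (x + y)) - h c = (h (c + x) - h c) + (h (c + y) - h c)).
    { intros x y Hx Hy Hxy. unfold d in Hxy.
      assert (E1 := Hadd c (c + (x + y)) ltac:(lra) ltac:(lra) ltac:(lra)).
      assert (E2 := Hadd (c + x) (c + y) ltac:(lra) ltac:(lra) ltac:(lra)).
      replace (c + x + (c + y)) with (c + (c + (x + y))) in E2 by ring. lra. }
    assert (HB : forall x, 0 <= x < d -> Rabs (h (c + x) - h c) <= 2 * C).
    { intros x Hx. unfold d in Hx.
      assert (B1 := Hb (c + x) ltac:(lra)). assert (B2 := Hb c ltac:(lra)).
      apply Rabs_le. apply Rabs_le_between in B1. apply Rabs_le_between in B2.
      lra. }
    set (m := (h (c + c) - h c) / c).
    assert (Hm : forall r, 0 <= r < d -> h (c + r) - h c = m * r).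
    { intros r Hr.
      assert (L : forall e, c <= e < d -> r <= e ->
        h (c + r) - h c = (h (c + e) - h c) / e * r /\
        h (c + c) - h c = (h (c + e) - h c) / e * c).
      { intros e He Hre.
        split; apply (additive_bounded_linear
                        (fun x => h (c + x) - h c) d e (2 * C)); auto; lra. }
      destruct (L (Rmax c r)) as [L1 L2].
      - unfold Rmax, d in *; destruct (Rle_dec c r); lra.
      - apply Rmax_r.
      - unfold m. rewrite L2, L1 at 1. field. split; [|lra].
        assert (c <= Rmax c r) by apply Rmax_l. lra. }
    assert (Hcc : h (c + c) = h c + h c) by (apply Hadd; lra).
    assert (Hhc : h c = m * c) by (unfold m; rewrite Hcc; field; lra).
    exists m. intros x Hx. destruct (Rlt_le_dec (x - c) d) as [Hxd|Hxd].
    - assert (E := Hm (x - c) ltac:(lra)).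
      replace (c + (x - c)) with x in E by ring. lra.
    - unfold d in *.
      assert (E := Hm (x - c - c) ltac:(lra)).
      assert (E' := Hadd c (x - c) ltac:(lra) ltac:(lra) ltac:(lra)).
      replace (c + (x - c)) with x in E' by ring.
      replace (c + (x - c - c)) with (x - c) in E by ring. lra. }
  (* any base point in [(a, b / 3)] would do *)
  set (c := (a + b / 3) / 2).
  destruct (Hc c ltac:(unfold c; lra) ltac:(unfold c; lra)) as [m Hm].
  exists m. intros x Hx. destruct (Rlt_le_dec x c) as [Hxc|Hxc].
  - destruct (Hc x ltac:(lra) ltac:(unfold c in *; lra)) as [m' Hm'].
    assert (E := Hm c ltac:(unfold c in *; lra)).
    assert (E' := Hm' c ltac:(unfold c in *; lra)).
    assert (m' = m). { apply Rmult_eq_reg_r with c; unfold c in *; lra. }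
    subst m'. apply Hm'. lra.
  - apply Hm. lra.
Qed.

(** * Exact arithmetic with numbers [a + b * sqrt 2] *)

Definition surd : Type := (Z * Z)%type.

Definition surdR (p : surd) : R := IZR (fst p) + IZR (snd p) * sqrt 2.

Definition sadd (p q : surd) : surd := (fst p + fst q, snd p + snd q)%Z.
Definition ssub (p q : surd) : surd := (fst p - fst q, snd p - snd q)%Z.
Definition smul (m : Z) (p : surd) : surd := (m * fst p, m * snd p)%Z.

Lemma surdR_add : forall p q, surdR (sadd p q) = surdR p + surdR q.
Proof. intros. unfold surdR, sadd; simpl. rewrite !plus_IZR. ring. Qed.

Lemma surdR_sub : forall p q, surdR (ssub p q) = surdR p - surdR q.
Proof. intros. unfold surdR, ssub; simpl. rewrite !minus_IZR. ring. Qed.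

Lemma surdR_mul : forall m p, surdR (smul m p) = IZR m * surdR p.
Proof. intros. unfold surdR, smul; simpl. rewrite !mult_IZR. ring. Qed.

(** Eleven decimals of [sqrt 2] decide every sign that occurs below; the test is
    exact when the value is [0]. *)
Definition root_den : Z := 100000000000.
Definition root_lo : Z := 141421356237.
Definition root_hi : Z := 141421356238.

Definition sscaled (p : surd) : Z :=
  (root_den * fst p + (if 0 <=? snd p then root_lo else root_hi) * snd p)%Z.

Definition sge0 (p : surd) : bool := (0 <=? sscaled p)%Z.
Definition sgt0 (p : surd) : bool := (0 <? sscaled p)%Z.

Lemma sqrt2_bounds : IZR root_lo / IZR root_den < sqrt 2 < IZR root_hi / IZR root_den.
Proof.
  unfold root_lo, root_hi, root_den.
  split.
  - rewrite <- (sqrt_Rsqr (141421356237 / 100000000000)) by lra.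
    apply sqrt_lt_1; unfold Rsqr; lra.
  - rewrite <- (sqrt_Rsqr (141421356238 / 100000000000)) by lra.
    apply sqrt_lt_1; unfold Rsqr; lra.
Qed.

Lemma sscaled_le : forall p, IZR (sscaled p) <= IZR root_den * surdR p.
Proof.
  intros [a b]. assert (Hs := sqrt2_bounds). unfold sscaled, surdR; cbn [fst snd].
  rewrite plus_IZR, !mult_IZR.
  unfold root_den, root_lo, root_hi in *.
  destruct (Z.leb_spec 0 b) as [Hb|Hb].
  - apply IZR_le in Hb. nra.
  - apply IZR_lt in Hb. nra.
Qed.

Lemma sge0_sound : forall p, sge0 p = true -> 0 <= surdR p.
Proof.
  intros p Hp. apply Z.leb_le, IZR_le in Hp.
  assert (H := sscaled_le p). unfold root_den in H. lra.
Qed.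

Lemma sgt0_sound : forall p, sgt0 p = true -> 0 < surdR p.
Proof.
  intros p Hp. apply Z.ltb_lt, IZR_lt in Hp.
  assert (H := sscaled_le p). unfold root_den in H. lra.
Qed.

Definition seqb (p q : surd) : bool :=
  (fst p =? fst q)%Z && (snd p =? snd q)%Z.

Lemma seqb_sound : forall p q, seqb p q = true -> p = q.
Proof.
  intros [a b] [c d]. unfold seqb; simpl. rewrite andb_true_iff, !Z.eqb_eq.
  intros [-> ->]. reflexivity.
Qed.

(** * The faces of [pi] *)

(** Breakpoints are integral multiples of [1 / pos_den], slopes of
    [1 / slope_den], and values of [1 / val_den]; as [val_den] is the product
    of the other two, a slope times a position is again an integral number of
    value units. *)
Definition pos_den : Z := 17887740000.
Definition slope_den : Z := 155987.
Definition val_den : Z := (pos_den * slope_den)%Z.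

Definition posR (p : surd) : R := surdR p / IZR pos_den.
Definition valR (p : surd) : R := surdR p / IZR val_den.
Definition slopeR (m : Z) : R := IZR m / IZR slope_den.

Lemma val_den_eq : IZR val_den = IZR pos_den * IZR slope_den.
Proof. unfold val_den. now rewrite mult_IZR. Qed.

Lemma dens_pos : 0 < IZR pos_den /\ 0 < IZR slope_den /\ 0 < IZR val_den.
Proof. repeat split; apply IZR_lt; reflexivity. Qed.

Lemma posR_add : forall p q, posR (sadd p q) = posR p + posR q.
Proof. intros. unfold posR. rewrite surdR_add. field. apply Rgt_not_eq, dens_pos. Qed.

Lemma posR_sub : forall p q, posR (ssub p q) = posR p - posR q.
Proof. intros. unfold posR. rewrite surdR_sub. field. apply Rgt_not_eq, dens_pos. Qed.

Lemma valR_add : forall p q, valR (sadd p q) = valR p + valR q.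
Proof. intros. unfold valR. rewrite surdR_add. field. apply Rgt_not_eq, dens_pos. Qed.

Lemma valR_sub : forall p q, valR (ssub p q) = valR p - valR q.
Proof. intros. unfold valR. rewrite surdR_sub. field. apply Rgt_not_eq, dens_pos. Qed.

Lemma valR_mul : forall m p, valR (smul m p) = slopeR m * posR p.
Proof.
  intros. unfold valR, slopeR, posR. rewrite surdR_mul, val_den_eq. field.
  split; apply Rgt_not_eq, dens_pos.
Qed.

Lemma posR_le : forall p q, sge0 (ssub q p) = true -> posR p <= posR q.
Proof.
  intros p q H. apply sge0_sound in H. rewrite surdR_sub in H.
  apply Rmult_le_compat_r; [| lra]. apply Rlt_le, Rinv_0_lt_compat, dens_pos.
Qed.

Lemma posR_lt : forall p q, sgt0 (ssub q p) = true -> posR p < posR q.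
Proof.
  intros p q H. apply sgt0_sound in H. rewrite surdR_sub in H.
  apply Rmult_lt_compat_r; [| lra]. apply Rinv_0_lt_compat, dens_pos.
Qed.

Lemma valR_ge0 : forall p, sge0 p = true -> 0 <= valR p.
Proof.
  intros p H. apply sge0_sound in H. apply Rdiv_le_0_compat; [lra | apply dens_pos].
Qed.

Lemma valR_gt0 : forall p, sgt0 p = true -> 0 < valR p.
Proof.
  intros p H. apply sgt0_sound in H. apply Rdiv_lt_0_compat; [lra | apply dens_pos].
Qed.

(** A face is a breakpoint or an open interval between consecutive
    breakpoints, together with the affine function that [pi] is there. *)
Record face : Type :=
  Face { fopen : bool; flo : surd; fhi : surd; fval : surd; fslope : Z }.

Definition in_face (F : face) (x : R) : Prop :=
  if fopen F then posR (flo F) < x < posR (fhi F) else x = posR (flo F).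

Definition face_fun (F : face) (x : R) : R :=
  valR (fval F) + slopeR (fslope F) * (x - posR (flo F)).

Record zentry : Type :=
  ZEntry { zbkpt : surd; zvalue : surd; zrlim : surd; zslope : Z }.

Definition zentryR (z : zentry) : entry :=
  Entry (posR (zbkpt z)) (valR (zvalue z)) (valR (zrlim z)) (slopeR (zslope z)).

Definition point_face (z : zentry) : face :=
  Face false (zbkpt z) (zbkpt z) (zvalue z) 0.

Definition interval_face (z : zentry) (e : surd) : face :=
  Face true (zbkpt z) e (zrlim z) (zslope z).

Fixpoint table_faces (z : zentry) (zs : list zentry) (e : surd) : list face :=
  match zs with
  | [] => [point_face z; interval_face z e]
  | z' :: zs' =>
      point_face z :: interval_face z (zbkpt z') :: table_faces z' zs' e
  end.

Fixpoint increasing (z : zentry) (zs : list zentry) (e : surd) : bool :=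
  match zs with
  | [] => sgt0 (ssub e (zbkpt z))
  | z' :: zs' => sgt0 (ssub (zbkpt z') (zbkpt z)) && increasing z' zs' e
  end.

Lemma table_faces_cover : forall zs z e x,
  posR (zbkpt z) <= x < posR e ->
  exists F, In F (table_faces z zs e) /\ in_face F x.
Proof.
  assert (Hcell : forall z e x, posR (zbkpt z) <= x < posR e ->
    in_face (point_face z) x \/ in_face (interval_face z e) x).
  { intros z e x Hx. unfold in_face; simpl.
    destruct (Req_dec x (posR (zbkpt z))); [now left | right; lra]. }
  induction zs as [|z' zs IH]; intros z e x Hx; simpl.
  - destruct (Hcell z e x Hx); eauto.
  - destruct (Rlt_le_dec x (posR (zbkpt z'))) as [Hlt|Hle].
    + destruct (Hcell z (zbkpt z') x ltac:(lra)); eauto.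
    + destruct (IH z' e x ltac:(lra)) as [F [HF Hx']]. eauto.
Qed.

Lemma table_faces_eval : forall zs z e F x,
  increasing z zs e = true -> In F (table_faces z zs e) -> in_face F x ->
  posR (zbkpt z) <= x < posR e /\
  eval_table (zentryR z) (map zentryR zs) x = face_fun F x.
Proof.
  assert (Hpt : forall z x, in_face (point_face z) x ->
    x = posR (zbkpt z) /\ eval_entry (zentryR z) x = face_fun (point_face z) x).
  { intros z x Hx. unfold in_face in Hx; simpl in Hx. split; [exact Hx |].
    unfold eval_entry, face_fun, slopeR; simpl.
    destruct (Req_dec_T x (posR (zbkpt z))); [| easy].
    unfold Rdiv. rewrite Rmult_0_l. ring. }
  assert (Hiv : forall z e x, in_face (interval_face z e) x ->
    posR (zbkpt z) < x < posR e /\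
    eval_entry (zentryR z) x = face_fun (interval_face z e) x).
  { intros z e x Hx. unfold in_face in Hx; simpl in Hx. split; [exact Hx |].
    unfold eval_entry, face_fun; simpl.
    destruct (Req_dec_T x (posR (zbkpt z))); [lra | reflexivity]. }
  induction zs as [|z' zs IH]; intros z e F x Hinc HF Hx; simpl in Hinc, HF.
  - apply posR_lt in Hinc. simpl. destruct HF as [<-|[<-|[]]].
    + destruct (Hpt z x Hx) as [-> E]. split; [lra | exact E].
    + destruct (Hiv z e x Hx) as [H1 E]. split; [lra | exact E].
  - apply andb_true_iff in Hinc as [H1 Hinc]. apply posR_lt in H1.
    assert (H2 : posR (zbkpt z') < posR e).
    { clear - Hinc. revert z' Hinc. induction zs as [|y zs IH]; simpl; intros z' H.
      - now apply posR_lt.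
      - apply andb_true_iff in H as [H H']. apply posR_lt in H.
        apply IH in H'. lra. }
    simpl. destruct HF as [<-|[<-|HF]].
    + destruct (Hpt z x Hx) as [-> E].
      destruct (Rlt_dec (posR (zbkpt z)) (posR (zbkpt z'))); [|lra].
      split; [lra | exact E].
    + destruct (Hiv z (zbkpt z') x Hx) as [H3 E].
      destruct (Rlt_dec x (posR (zbkpt z'))); [|lra].
      split; [lra | exact E].
    + destruct (IH z' e F x Hinc HF Hx) as [H3 E].
      destruct (Rlt_dec x (posR (zbkpt z'))); [lra |].
      split; [lra | exact E].
Qed.

(** ** The two tables *)

(** Pairs [(a, b)] of fractions stand for [a + b * sqrt 2]. *)
Record qentry : Type :=
  QEntry { qbkpt : Q * Q; qvalue : Q * Q; qrlim : Q * Q; qslope : Z }.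

Definition qR (p : Q * Q) : R := Q2R (fst p) + Q2R (snd p) * sqrt 2.

Definition qentryR (e : qentry) : entry :=
  Entry (qR (qbkpt e)) (qR (qvalue e)) (qR (qrlim e)) (slopeR (qslope e)).

Definition scale (D : Z) (a : Q) : Z := (Qnum a * (D / Zpos (Qden a)))%Z.
Definition scale_ok (D : Z) (a : Q) : bool := (D mod Zpos (Qden a) =? 0)%Z.

Definition sscale (D : Z) (p : Q * Q) : surd := (scale D (fst p), scale D (snd p)).
Definition sscale_ok (D : Z) (p : Q * Q) : bool :=
  scale_ok D (fst p) && scale_ok D (snd p).

Lemma scale_sound : forall D a, (0 < D)%Z -> scale_ok D a = true ->
  IZR (scale D a) / IZR D = Q2R a.
Proof.
  intros D [n d] HD H. apply Z.eqb_eq in H. simpl in H.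
  unfold scale, Q2R; simpl.
  set (q := (D / Zpos d)%Z).
  assert (E : D = (Zpos d * q)%Z).
  { unfold q. rewrite (Z.div_mod D (Zpos d)) at 1 by easy. rewrite H. ring. }
  clearbody q. subst D. apply IZR_lt in HD. rewrite mult_IZR in HD |- *.
  assert (Hd : 0 < IZR (Zpos d)) by (apply IZR_lt; reflexivity).
  rewrite mult_IZR. field. split; intros Hz; rewrite Hz in *; lra.
Qed.

Lemma sscale_sound : forall D p, (0 < D)%Z -> sscale_ok D p = true ->
  surdR (sscale D p) / IZR D = qR p.
Proof.
  intros D [a b] HD H. apply andb_true_iff in H as [Ha Hb]. simpl in *.
  unfold surdR, qR; simpl. rewrite <- (scale_sound D a), <- (scale_sound D b); auto.
  field. apply Rgt_not_eq, IZR_lt. lia.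
Qed.

Definition zentry_of (e : qentry) : zentry :=
  ZEntry (sscale pos_den (qbkpt e)) (sscale val_den (qvalue e))
         (sscale val_den (qrlim e)) (qslope e).

Definition qentry_ok (e : qentry) : bool :=
  sscale_ok pos_den (qbkpt e) && sscale_ok val_den (qvalue e) &&
  sscale_ok val_den (qrlim e).

Lemma zentry_of_sound : forall e, qentry_ok e = true ->
  zentryR (zentry_of e) = qentryR e.
Proof.
  intros e H. apply andb_true_iff in H as [H H3].
  apply andb_true_iff in H as [H1 H2].
  unfold zentryR, qentryR, posR, valR; simpl.
  rewrite !sscale_sound; auto; reflexivity.
Qed.

Definition s1 : Z := 419965.
Definition s2 : Z := 65.
Definition s3 : Z := -779935.

Lemma slopeR_s1 : slopeR s1 = c1.
Proof. unfold slopeR, s1, slope_den, c1. lra. Qed.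
Lemma slopeR_s2 : slopeR s2 = c2.
Proof. unfold slopeR, s2, slope_den, c2. lra. Qed.
Lemma slopeR_s3 : slopeR s3 = c3.
Proof. unfold slopeR, s3, slope_den, c3. lra. Qed.

Definition rc_qentry (x v : Q * Q) (m : Z) : qentry := QEntry x v v m.

Open Scope Q_scope.

Definition lower_head : qentry := QEntry (0, 0) (0, 0) (101 # 650, 0) s3.

Definition lower_tail : list qentry :=
  [ QEntry (101 # 5000, 0) (2727 # 13000, 0) (707 # 13000, 0) s1;
    rc_qentry (60153 # 369200, 0) (421071 # 959920, 0) s3;
    QEntry (849 # 5000, 0)
      (4851099 # 11999000, -1925 # 71994) (4851099 # 11999000, 0) s1;
    rc_qentry (849 # 5000, 1925 # 298129)
      (4851099 # 11999000, 67375 # 3875677) s3;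
    QEntry (849 # 5000, 77 # 7752)
      (4851099 # 11999000, 2695 # 100776)
      (4851099 # 11999000, 385 # 93016248) s1;
    QEntry (19 # 100, 0) (18196 # 59995, 0) (275183 # 599950, -1925 # 71994) s1;
    rc_qentry (281986521 # 1490645000, 77 # 22152)
      (10467633 # 22933000, -385 # 22152) s3;
    QEntry (40294 # 201875, 0) (795836841 # 1937838500, 0)
      (848837 # 2099500, 0) s1;
    rc_qentry (36999 # 184600, 0) (975607 # 2399800, 0) s3;
    QEntry (19 # 100, 77 # 7752)
      (18196 # 59995, 385 # 93016248) (275183 # 599950, -385 # 7752) s3;
    QEntry (1051 # 5000, 0)
      (4291761 # 11999000, -1925 # 71994) (4291761 # 11999000, 0) s1;
    rc_qentry (1051 # 5000, 1925 # 298129)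
      (4291761 # 11999000, 67375 # 3875677) s3;
    QEntry (14199 # 64600, 0)
      (50943 # 167960, 0) (240046061 # 775135400, 192500 # 3875677) s3;
    QEntry (1051 # 5000, 77 # 7752)
      (4291761 # 11999000, 2695 # 100776)
      (4291761 # 11999000, 385 # 93016248) s1;
    rc_qentry (342208579 # 1490645000, 77 # 22152)
      (122181831 # 298129000, -385 # 22152) s3;
    rc_qentry (193799 # 807500, 0) (187742 # 524875, 0) s1;
    QEntry (219 # 800, 0) (933 # 2080, 0) (51443 # 147680, 0) s2;
    rc_qentry (269 # 800, 0) (683 # 2080, 0) s1 ].

Definition upper_head : qentry := QEntry (4 # 5, 0) (1, 0) (549 # 650, 0) s1.

Definition upper_tail : list qentry :=
  [ QEntry (4101 # 5000, 0) (9667 # 13000, 0) (899 # 1000, 0) s3;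
    QEntry (4899 # 5000, 0) (3333 # 13000, 0) (101 # 1000, 0) s1 ].

Open Scope R_scope.

Ltac table_eq :=
  unfold qentryR, rc_entry, rc_qentry, qR; simpl; unfold Q2R; simpl;
  rewrite ?slopeR_s1, ?slopeR_s2, ?slopeR_s3; unfold f;
  repeat match goal with
  | |- Entry _ _ _ _ = Entry _ _ _ _ => apply f_equal4; try reflexivity; lra
  | |- _ :: _ = _ :: _ => apply f_equal2
  | |- [] = [] => reflexivity
  end.

Lemma table_of_qtable : forall e es,
  forallb qentry_ok (e :: es) = true ->
  eval_table (qentryR e) (map qentryR es) =
  eval_table (zentryR (zentry_of e)) (map zentryR (map zentry_of es)).
Proof.
  intros e es H. simpl in H. apply andb_true_iff in H as [He Hes].
  rewrite zentry_of_sound by exact He. f_equal.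
  rewrite map_map. apply map_ext_in. intros a Ha. symmetry.
  apply zentry_of_sound. rewrite forallb_forall in Hes. auto.
Qed.

Definition zlower_head : zentry := Eval vm_compute in zentry_of lower_head.
Definition zlower_tail : list zentry := Eval vm_compute in map zentry_of lower_tail.
Definition zupper_head : zentry := Eval vm_compute in zentry_of upper_head.
Definition zupper_tail : list zentry := Eval vm_compute in map zentry_of upper_tail.

Lemma pi_lower_table :
  pi_lower = eval_table (zentryR zlower_head) (map zentryR zlower_tail).
Proof.
  change zlower_head with (zentry_of lower_head).
  replace zlower_tail with (map zentry_of lower_tail) by (vm_compute; reflexivity).
  rewrite <- table_of_qtable by (vm_compute; reflexivity).
  unfold pi_lower. apply f_equal2.
  - unfold lower_head. table_eq.
  - unfold lower_tail, map. table_eq.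
Qed.

Lemma pi_upper_table :
  pi_upper = eval_table (zentryR zupper_head) (map zentryR zupper_tail).
Proof.
  replace zupper_head with (zentry_of upper_head) by (vm_compute; reflexivity).
  replace zupper_tail with (map zentry_of upper_tail) by (vm_compute; reflexivity).
  rewrite <- table_of_qtable by (vm_compute; reflexivity).
  unfold pi_upper. apply f_equal2.
  - unfold upper_head. table_eq.
  - unfold upper_tail, map. table_eq.
Qed.

Definition pos_f : surd := (14310192000, 0)%Z.
Definition pos_one : surd := (pos_den, 0%Z).
Definition val_one : surd := (val_den, 0%Z).
Definition lower_end : surd := (8295439425, 0)%Z.

Lemma posR_f : posR pos_f = f.
Proof. unfold posR, surdR, pos_f, pos_den, f; simpl. field. Qed.
Lemma posR_one : posR pos_one = 1.
Proof. unfold posR, surdR, pos_one; simpl. field. apply Rgt_not_eq, dens_pos. Qed.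
Lemma valR_one : valR val_one = 1.
Proof.
  unfold valR, surdR, val_one; simpl. rewrite Rmult_0_l, Rplus_0_r. apply Rdiv_diag.
  apply Rgt_not_eq, dens_pos.
Qed.
Lemma posR_lower_end : posR lower_end = 371 / 800.
Proof. unfold posR, surdR, lower_end, pos_den; simpl. field. Qed.

(** The image of a face of [[0, f / 2)] under [x |-> f - x], on which
    [pi x = 1 - pi (f - x)]. *)
Definition mirror (F : face) : face :=
  Face (fopen F) (ssub pos_f (fhi F)) (ssub pos_f (flo F))
    (ssub val_one (sadd (fval F) (smul (fslope F) (ssub (fhi F) (flo F)))))
    (fslope F).

Lemma face_fun_mirror : forall F x,
  face_fun (mirror F) x = 1 - face_fun F (f - x).
Proof.
  intros F x. unfold face_fun, mirror; simpl.
  rewrite valR_sub, valR_add, valR_mul, !posR_sub, valR_one, posR_f. ring.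
Qed.

Definition lower_faces : list face :=
  Eval vm_compute in table_faces zlower_head zlower_tail lower_end.

Definition upper_faces : list face :=
  Eval vm_compute in table_faces zupper_head zupper_tail pos_one.

(** The last lower face contains [f / 2] and is its own mirror image; the first
    upper face is the point [f], which is also the mirror image of [0]. *)
Definition faces : list face :=
  lower_faces ++ rev (map mirror (removelast lower_faces)) ++ tl upper_faces.

Definition no_face : face := Face false (0, 0)%Z (0, 0)%Z (0, 0)%Z 0.

Definition face_list : list face := Eval vm_compute in faces.

(** The breakpoints of [pi] in [[0, 1)] are numbered from [0] to [39];
    [pt i] is the [i]-th one, and [iv i] the open interval that follows it. *)
Definition pt (i : nat) : face := nth (2 * i) face_list no_face.
Definition iv (i : nat) : face := nth (2 * i + 1) face_list no_face.

Lemma lower_faces_eq : lower_faces = table_faces zlower_head zlower_tail lower_end.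
Proof. reflexivity. Qed.

Lemma upper_faces_eq : upper_faces = table_faces zupper_head zupper_tail pos_one.
Proof. reflexivity. Qed.

Definition middle_face : face := Eval vm_compute in last lower_faces no_face.

Lemma lower_faces_split : lower_faces = removelast lower_faces ++ [middle_face].
Proof. reflexivity. Qed.

Lemma in_middle_face : forall x, in_face middle_face x <-> 269 / 800 < x < 371 / 800.
Proof.
  intros x. unfold in_face, middle_face, posR, surdR, pos_den; simpl. lra.
Qed.

Lemma middle_face_fun : forall x,
  face_fun middle_face x = 683 / 2080 + c1 * (x - 269 / 800).
Proof.
  intros x. unfold face_fun, middle_face; simpl.
  change 419965%Z with s1. rewrite slopeR_s1.
  unfold posR, valR, surdR, val_den, pos_den, slope_den; simpl. unfold c1. lra.
Qed.

Lemma pi_lower_face : forall F x, In F lower_faces -> in_face F x ->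
  0 <= x < 371 / 800 /\ pi_lower x = face_fun F x.
Proof.
  intros F x HF Hx. rewrite lower_faces_eq in HF.
  apply table_faces_eval with (x := x) in HF; [| vm_compute; reflexivity | exact Hx].
  rewrite pi_lower_table, <- posR_lower_end.
  destruct HF as [H1 H2]. split; [| exact H2].
  revert H1. unfold posR, surdR; simpl. unfold Rdiv.
  now rewrite Rmult_0_l, Rplus_0_l, Rmult_0_l.
Qed.

Lemma pi_upper_face : forall F x, In F upper_faces -> in_face F x ->
  f <= x < 1 /\ pi_upper x = face_fun F x.
Proof.
  intros F x HF Hx. rewrite upper_faces_eq in HF.
  apply table_faces_eval with (x := x) in HF; [| vm_compute; reflexivity | exact Hx].
  rewrite pi_upper_table, <- posR_one, <- posR_f. exact HF.
Qed.

Lemma in_face_le : forall F x, in_face F x ->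
  sge0 (ssub (fhi F) (flo F)) = true -> posR (flo F) <= x <= posR (fhi F).
Proof.
  intros F x Hx H. apply posR_le in H. unfold in_face in Hx.
  destruct (fopen F); lra.
Qed.

Lemma pi_unit_face : forall F x, In F faces -> in_face F x ->
  0 <= x < 1 /\ pi_unit x = face_fun F x.
Proof.
  intros F x HF Hx. unfold faces in HF. rewrite !in_app_iff in HF.
  assert (Hfv : f = 4 / 5) by reflexivity.
  unfold pi_unit. destruct HF as [HF|[HF|HF]].
  - destruct (pi_lower_face F x HF Hx) as [H1 H2]. split; [lra |].
    destruct (Rle_dec x (f / 2)) as [_|Hf]; [exact H2 |].
    destruct (Rle_dec x f) as [_|Hf']; [| lra].
    assert (Hlast : In middle_face lower_faces)
      by (rewrite lower_faces_split, in_app_iff; right; now left).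
    rewrite <- H2.
    destruct (pi_lower_face middle_face x Hlast) as [_ ->].
    { apply in_middle_face. lra. }
    destruct (pi_lower_face middle_face (f - x) Hlast) as [_ ->].
    { apply in_middle_face. lra. }
    rewrite !middle_face_fun. unfold f, c1. lra.
  - apply in_rev, in_map_iff in HF. destruct HF as [G [<- HG]].
    assert (HG' : In G lower_faces)
      by (rewrite lower_faces_split, in_app_iff; now left).
    assert (Hx' : in_face G (f - x)).
    { unfold in_face, mirror in Hx |- *; simpl in Hx.
      rewrite !posR_sub, posR_f in Hx.
      assert (Hp : forallb (fun F => fopen F || seqb (flo F) (fhi F)) lower_faces = true)
        by (vm_compute; reflexivity).
      rewrite forallb_forall in Hp. specialize (Hp G HG').
      destruct (fopen G); [lra |]. apply seqb_sound in Hp. rewrite Hp. lra. }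
    destruct (pi_lower_face G (f - x) HG' Hx') as [H1 H2].
    assert (Hb : forallb (fun F => sge0 (ssub (flo middle_face) (fhi F))
                                   && sge0 (ssub (fhi F) (flo F)))
                         (removelast lower_faces) = true) by (vm_compute; reflexivity).
    rewrite forallb_forall in Hb. specialize (Hb G HG).
    apply andb_true_iff in Hb as [Hb Hb']. apply posR_le in Hb.
    apply in_face_le in Hx'; [| exact Hb'].
    assert (Em : posR (flo middle_face) = 269 / 800)
      by (unfold posR, surdR, middle_face, pos_den; simpl; lra).
    rewrite face_fun_mirror, <- H2.
    destruct (Rle_dec x (f / 2)); [lra |].
    destruct (Rle_dec x f); [| lra]. split; [lra | reflexivity].
  - assert (HF' : In F upper_faces) by now right.
    destruct (pi_upper_face F x HF' Hx) as [H1 H2].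
    assert (Hf : f < x).
    { assert (Hb : forallb (fun F => if fopen F then sge0 (ssub (flo F) pos_f)
                                     else sgt0 (ssub (flo F) pos_f))
                           (tl upper_faces) = true) by (vm_compute; reflexivity).
      rewrite forallb_forall in Hb. specialize (Hb F HF).
      unfold in_face in Hx. rewrite <- posR_f. destruct (fopen F).
      - apply posR_le in Hb. lra.
      - apply posR_lt in Hb. lra. }
    destruct (Rle_dec x (f / 2)); [lra |]. destruct (Rle_dec x f); [lra |].
    split; [lra | exact H2].
Qed.

Lemma faces_cover : forall x, 0 <= x < 1 -> exists F, In F faces /\ in_face F x.
Proof.
  intros x Hx. assert (Hfv : f = 4 / 5) by reflexivity.
  assert (Hlow : forall y, 0 <= y < 371 / 800 ->
    exists F, In F lower_faces /\ in_face F y).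
  { intros y Hy. rewrite lower_faces_eq. apply table_faces_cover.
    rewrite posR_lower_end. unfold posR, surdR; simpl.
    unfold Rdiv at 1. now rewrite Rmult_0_l, Rplus_0_l, Rmult_0_l. }
  unfold faces. destruct (Rle_lt_dec x (f / 2)) as [H2|H2].
  { destruct (Hlow x ltac:(lra)) as [F [HF HFx]].
    exists F. rewrite in_app_iff. auto. }
  destruct (Rle_lt_dec x f) as [Hf|Hf].
  - destruct (Hlow (f - x) ltac:(lra)) as [F [HF HFx]].
    assert (HF' := HF). rewrite lower_faces_split, in_app_iff in HF'.
    destruct HF' as [HF'|[<-|[]]].
    + exists (mirror F). split.
      * rewrite !in_app_iff. right; left. apply -> in_rev. now apply in_map.
      * unfold in_face, mirror in *; simpl. rewrite !posR_sub, posR_f.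
        assert (Hp : forallb (fun F => fopen F || seqb (flo F) (fhi F)) lower_faces = true)
          by (vm_compute; reflexivity).
        rewrite forallb_forall in Hp. specialize (Hp F HF).
        destruct (fopen F); [lra |]. apply seqb_sound in Hp. rewrite <- Hp. lra.
    + exists middle_face. split; [rewrite in_app_iff; auto |].
      apply in_middle_face. apply in_middle_face in HFx. lra.
  - destruct (table_faces_cover zupper_tail zupper_head pos_one x) as [F [HF HFx]].
    { rewrite posR_one. change (zbkpt zupper_head) with pos_f. rewrite posR_f. lra. }
    rewrite <- upper_faces_eq in HF.
    destruct HF as [<-|HF].
    + exfalso. unfold in_face in HFx; simpl in HFx.
      change (14310192000%Z, 0%Z) with pos_f in HFx. rewrite posR_f in HFx. lra.
    + exists F. rewrite !in_app_iff. auto.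
Qed.

Lemma frac_part_id : forall x, 0 <= x < 1 -> frac_part x = x.
Proof.
  intros x Hx. assert (E := Int_part_spec x 0). simpl in E.
  unfold frac_part. rewrite <- E by lra. simpl. lra.
Qed.

Lemma pi_face : forall F x, In F faces -> in_face F x -> pi x = face_fun F x.
Proof.
  intros F x HF Hx. destruct (pi_unit_face F x HF Hx) as [H1 H2].
  unfold pi. now rewrite frac_part_id.
Qed.

(** * Perturbations *)

(** A perturbation lives on [(l, u)].  It is odd under the three reflections at
    which [pi] is additive, so it is constant on the classes modulo [T]; the
    bound [s] is what the smallest gap of the three-term sum allows. *)
Definition perturbation (p : R -> R) : Prop :=
  forall x, l < x < u ->
    Rabs (p x) <= s /\
    forall t, t = 0 \/ t = t1 \/ t = t2 ->
      l < l + u - t - x < u -> p (l + u - t - x) = - p x.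

(** The values on [(f - u, f - l)] are those that keep the sum of the values at
    [x] and [f - x] equal to [1]. *)
Definition extend (p : R -> R) (x : R) : R :=
  if Rlt_dec l x then
    if Rlt_dec x u then p x
    else if Rlt_dec (f - u) x then
      if Rlt_dec x (f - l) then - p (f - x) else 0
    else 0
  else 0.

Lemma extend_lower : forall p x, l < x < u -> extend p x = p x.
Proof.
  intros p x Hx. unfold extend.
  destruct (Rlt_dec l x), (Rlt_dec x u); lra.
Qed.

Lemma extend_upper : forall p x, f - u < x < f - l -> extend p x = - p (f - x).
Proof.
  intros p x Hx. unfold extend.
  assert (Hu : u < f - u) by (unfold u, f; lra).
  assert (Hl : l < u) by (unfold l, u; lra).
  destruct (Rlt_dec l x), (Rlt_dec x u), (Rlt_dec (f - u) x), (Rlt_dec x (f - l)); lra.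
Qed.

Lemma extend_outside : forall p x,
  ~ (l < x < u) -> ~ (f - u < x < f - l) -> extend p x = 0.
Proof.
  intros p x H1 H2. unfold extend.
  destruct (Rlt_dec l x), (Rlt_dec x u), (Rlt_dec (f - u) x), (Rlt_dec x (f - l)); lra.
Qed.

Lemma extend_bound : forall p x, perturbation p -> Rabs (extend p x) <= s.
Proof.
  intros p x Hp. assert (Hs : 0 < s) by (unfold s; lra).
  destruct (classic (l < x < u)) as [H1|H1].
  { rewrite extend_lower by exact H1. now apply Hp. }
  destruct (classic (f - u < x < f - l)) as [H2|H2].
  { rewrite extend_upper, Rabs_Ropp by exact H2. apply Hp. lra. }
  rewrite extend_outside, Rabs_R0; auto; lra.
Qed.

(** * Linear programming bounds on triples of faces *)

(** Subtracting [slope * x] from [pi x] in each of the three terms changes the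
    sum by a constant, since [x + y + z] is fixed, and reduces minimization over
    the polygon of triples to three separate minimizations over intervals.  This
    is the Lagrangian dual of a linear program in which the multiplier can be
    taken among the slopes that occur. *)
Definition reduced_min (m : Z) (F : face) : surd :=
  if fopen F && (fslope F <? m)%Z
  then ssub (sadd (fval F) (smul (fslope F) (ssub (fhi F) (flo F)))) (smul m (fhi F))
  else ssub (fval F) (smul m (flo F)).

Lemma slopeR_sub : forall a b, slopeR (a - b) = slopeR a - slopeR b.
Proof. intros. unfold slopeR. rewrite minus_IZR. field. apply Rgt_not_eq, dens_pos. Qed.

Lemma slopeR_pos : forall a, (0 < a)%Z -> 0 < slopeR a.
Proof. intros a Ha. apply Rdiv_lt_0_compat; [now apply IZR_lt | apply dens_pos]. Qed.

Definition steep (m : Z) (F : face) : bool := fopen F && negb (fslope F =? m)%Z.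

Lemma reduced_min_le : forall m F x, in_face F x ->
  valR (reduced_min m F) <= face_fun F x - slopeR m * x /\
  (steep m F = true -> valR (reduced_min m F) < face_fun F x - slopeR m * x).
Proof.
  intros m F x Hx. unfold in_face in Hx. unfold reduced_min, steep, face_fun.
  destruct (fopen F); simpl.
  - destruct (Z.ltb_spec (fslope F) m) as [H|H].
    + assert (Hm := slopeR_pos (m - fslope F) ltac:(lia)). rewrite slopeR_sub in Hm.
      rewrite valR_sub, valR_add, !valR_mul, posR_sub. split; [|intros _]; nra.
    + rewrite valR_sub, valR_mul. destruct (Z.eqb_spec (fslope F) m) as [->|Hne].
      * simpl. split; [lra | easy].
      * assert (Hm := slopeR_pos (fslope F - m) ltac:(lia)). rewrite slopeR_sub in Hm.
        split; [|intros _]; nra.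
  - subst x. rewrite valR_sub, valR_mul. split; [lra | easy].
Qed.

Definition pos_l : surd := (4896768825, 0)%Z.
Definition pos_u : surd := (6014752575, 0)%Z.
Definition val_s : surd := (19 * (val_den / 23998), 0)%Z.

Lemma posR_l : posR pos_l = l.
Proof. unfold posR, surdR, pos_l, pos_den, l; simpl. field. Qed.
Lemma posR_u : posR pos_u = u.
Proof. unfold posR, surdR, pos_u, pos_den, u; simpl. field. Qed.
Lemma valR_s : valR val_s = s.
Proof.
  unfold valR, val_s, surdR, s. simpl fst; simpl snd.
  replace val_den with (116270310000 * 23998)%Z by reflexivity.
  replace (116270310000 * 23998 / 23998)%Z with 116270310000%Z by reflexivity.
  rewrite !mult_IZR. field.
Qed.

Definition apart (F : face) (a b : surd) : bool :=
  sge0 (ssub a (fhi F)) || sge0 (ssub (flo F) b).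

Definition within (F : face) (a b : surd) : bool :=
  fopen F && sge0 (ssub (flo F) a) && sge0 (ssub b (fhi F)).

Definition weight (F : face) : Z :=
  if apart F pos_l pos_u &&
     apart F (ssub pos_f pos_u) (ssub pos_f pos_l) then 0%Z else 1%Z.

Definition well_formed (F : face) : bool :=
  if fopen F then sgt0 (ssub (fhi F) (flo F)) else seqb (flo F) (fhi F).

Lemma in_face_bounds : forall F x, in_face F x -> well_formed F = true ->
  if fopen F then posR (flo F) < x < posR (fhi F)
  else x = posR (flo F) /\ x = posR (fhi F).
Proof.
  intros F x Hx H. unfold in_face in Hx. unfold well_formed in H.
  destruct (fopen F); [exact Hx |]. apply seqb_sound in H. rewrite <- H. auto.
Qed.

Lemma faces_well_formed : forall F, In F faces -> well_formed F = true.
Proof.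
  apply forallb_forall. vm_compute. reflexivity.
Qed.

Lemma apart_sound : forall F a b x, In F faces -> in_face F x ->
  apart F a b = true -> ~ (posR a < x < posR b).
Proof.
  intros F a b x HF Hx H. apply in_face_bounds in Hx; [| now apply faces_well_formed].
  apply orb_true_iff in H as [H|H]; apply posR_le in H; destruct (fopen F); lra.
Qed.

Lemma within_sound : forall F a b x, in_face F x ->
  within F a b = true -> posR a < x < posR b.
Proof.
  intros F a b x Hx H. unfold within in H. unfold in_face in Hx.
  apply andb_true_iff in H as [H H2]. apply andb_true_iff in H as [H H1].
  rewrite H in Hx. apply posR_le in H1. apply posR_le in H2. lra.
Qed.

Lemma weight_sound : forall p F x, perturbation p -> In F faces -> in_face F x ->
  Rabs (extend p x) <= IZR (weight F) * s.
Proof.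
  intros p F x Hp HF Hx. unfold weight.
  destruct (apart F pos_l pos_u) eqn:E1; simpl;
    [destruct (apart F (ssub pos_f pos_u) (ssub pos_f pos_l)) eqn:E2; simpl |];
    try (rewrite Rmult_1_l; now apply extend_bound).
  apply apart_sound with (x := x) in E1; auto.
  apply apart_sound with (x := x) in E2; auto.
  rewrite !posR_sub, posR_l, posR_u, posR_f in *.
  rewrite extend_outside, Rabs_R0; auto; lra.
Qed.

Definition pos_f_plus (k : Z) : surd := sadd pos_f (smul k pos_one).

Lemma posR_f_plus : forall k, posR (pos_f_plus k) = f + IZR k.
Proof.
  intros k. unfold pos_f_plus. rewrite posR_add, posR_f.
  unfold posR at 1. rewrite surdR_mul. fold (posR pos_one).
  unfold Rdiv. rewrite Rmult_assoc. fold (surdR pos_one / IZR pos_den).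
  fold (posR pos_one). rewrite posR_one. ring.
Qed.

(** Conditionals rather than boolean connectives, which a call-by-value
    evaluator would not cut short. *)
Definition infeasible (F1 F2 F3 : face) (k : Z) : bool :=
  let lo := ssub (sadd (flo F1) (sadd (flo F2) (flo F3))) (pos_f_plus k) in
  let hi := ssub (pos_f_plus k) (sadd (fhi F1) (sadd (fhi F2) (fhi F3))) in
  if fopen F1 || fopen F2 || fopen F3
  then if sge0 lo then true else sge0 hi
  else if sgt0 lo then true else sgt0 hi.

Lemma infeasible_sound : forall F1 F2 F3 k x y z,
  well_formed F1 = true -> well_formed F2 = true -> well_formed F3 = true ->
  in_face F1 x -> in_face F2 y -> in_face F3 z -> x + y + z = f + IZR k ->
  infeasible F1 F2 F3 k = false.
Proof.
  intros F1 F2 F3 k x y z H1 H2 H3 Hx Hy Hz Hk.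
  apply not_true_iff_false. intros H. unfold infeasible in H.
  apply in_face_bounds in Hx, Hy, Hz; auto.
  destruct (fopen F1), (fopen F2), (fopen F3); cbn [orb] in H;
    (match type of H with (if ?a then true else ?b) = true =>
       change (a || b = true) in H end);
    apply orb_true_iff in H as [H|H];
    (apply posR_le in H || apply posR_lt in H);
    rewrite !posR_add, posR_f_plus in H; lra.
Qed.

(** On these triples the perturbation terms cancel: [y] and [z] are exchanged
    either by [x |-> f - x] or by one of the reflections [x |-> l + u - t - x].
    They are the only ones where [pi] is additive and a summand lies in a
    perturbed interval. *)
Definition balanced (F1 F2 F3 : face) (k : Z) : bool :=
  negb (fopen F1) && (k =? 0)%Z && within F2 pos_l pos_u &&
  (seqb (flo F1) (0, 0)%Z && within F3 (ssub pos_f pos_u) (ssub pos_f pos_l) ||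
   within F3 pos_l pos_u &&
   existsb (fun t => seqb (flo F1) (ssub pos_f (ssub (sadd pos_l pos_u) t)))
     [(0, 0)%Z; (0, 177677500)%Z; (533032500, 0)%Z]).

Lemma posR_zero : posR (0, 0)%Z = 0.
Proof. unfold posR, surdR; simpl. lra. Qed.
Lemma posR_t1 : posR (0, 177677500)%Z = t1.
Proof. unfold posR, surdR, t1, pos_den; simpl. field. Qed.
Lemma posR_t2 : posR (533032500, 0)%Z = t2.
Proof. unfold posR, surdR, t2, pos_den; simpl. field. Qed.

Lemma balanced_sound : forall p F1 F2 F3 k x y z, perturbation p ->
  In F1 faces -> In F2 faces -> In F3 faces ->
  in_face F1 x -> in_face F2 y -> in_face F3 z -> x + y + z = f + IZR k ->
  balanced F1 F2 F3 k = true -> extend p x + extend p y + extend p z = 0.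
Proof.
  intros p F1 F2 F3 k x y z Hp H1 H2 H3 Hx Hy Hz Hk H.
  apply andb_true_iff in H as [H H4]. apply andb_true_iff in H as [H H5].
  apply andb_true_iff in H as [H H6]. apply negb_true_iff in H.
  apply Z.eqb_eq in H6. subst k. rewrite Rplus_0_r in Hk.
  unfold in_face in Hx. rewrite H in Hx.
  apply within_sound with (x := y) in H5; auto. rewrite posR_l, posR_u in H5.
  assert (Hc : l = 219 / 800 /\ u = 269 / 800 /\ f = 4 / 5) by auto.
  apply orb_true_iff in H4 as [H4|H4]; apply andb_true_iff in H4 as [H7 H8].
  - apply seqb_sound in H7. rewrite H7, posR_zero in Hx. subst x.
    apply within_sound with (x := z) in H8; auto.
    rewrite !posR_sub, posR_l, posR_u, posR_f in H8.
    rewrite extend_outside by lra. rewrite extend_lower, extend_upper by lra.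
    replace (f - z) with y by lra. lra.
  - apply within_sound with (x := z) in H7; auto. rewrite posR_l, posR_u in H7.
    apply existsb_exists in H8 as [t [Ht H8]]. apply seqb_sound in H8.
    rewrite H8 in Hx. rewrite !posR_sub, posR_add, posR_l, posR_u, posR_f in Hx.
    assert (Ht' : posR t = 0 \/ posR t = t1 \/ posR t = t2).
    { destruct Ht as [<-|[<-|[<-|[]]]];
        rewrite ?posR_zero, ?posR_t1, ?posR_t2; auto. }
    rewrite (extend_outside p x) by lra. rewrite !extend_lower by lra.
    replace z with (l + u - posR t - y) in * by lra.
    rewrite (proj2 (Hp y H5) (posR t)); auto; lra.
Qed.

(** With [w] summands in perturbed intervals the perturbation terms add up to at
    most [w * s].  Hence a gap above [w * s] is enough; so is a gap of exactly
    [w * s] when the bound is not attained, which is the case as soon as one of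
    the faces is open and [pi] does not have slope [m] on it. *)
Definition slope_test (m : Z) (F1 F2 F3 : face) (k : Z) : bool :=
  let gap := ssub (sadd (sadd (reduced_min m F1)
                              (sadd (reduced_min m F2) (reduced_min m F3)))
                        (smul m (pos_f_plus k))) val_one in
  let w := (weight F1 + weight F2 + weight F3)%Z in
  let gap' := ssub gap (smul w val_s) in
  (((w =? 0)%Z || balanced F1 F2 F3 k) && sge0 gap) || sgt0 gap' ||
  ((steep m F1 || steep m F2 || steep m F3) && sge0 gap').

Definition triple_test (F1 F2 F3 : face) (k : Z) : bool :=
  if infeasible F1 F2 F3 k then true
  else if slope_test s1 F1 F2 F3 k then true
  else if slope_test s2 F1 F2 F3 k then true
  else slope_test s3 F1 F2 F3 k.

(** Either way the perturbed sum is at least [1], and it is [1] exactly when the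
    unperturbed sum is. *)
Definition dichotomy (p : R -> R) (x y z : R) : Prop :=
  (1 <= pi x + pi y + pi z /\ extend p x + extend p y + extend p z = 0) \/
  (1 < pi x + pi y + pi z /\
   1 < pi x + pi y + pi z + (extend p x + extend p y + extend p z)).

Lemma triple_test_sound : forall p F1 F2 F3 k x y z, perturbation p ->
  In F1 faces -> In F2 faces -> In F3 faces ->
  in_face F1 x -> in_face F2 y -> in_face F3 z -> x + y + z = f + IZR k ->
  triple_test F1 F2 F3 k = true -> dichotomy p x y z.
Proof.
  intros p F1 F2 F3 k x y z Hp H1 H2 H3 Hx Hy Hz Hk H.
  assert (H' : exists m, slope_test m F1 F2 F3 k = true).
  { unfold triple_test in H.
    rewrite (infeasible_sound F1 F2 F3 k x y z) in H
      by (assumption || now apply faces_well_formed).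
    destruct (slope_test s1 F1 F2 F3 k) eqn:E1; [eauto |].
    destruct (slope_test s2 F1 F2 F3 k) eqn:E2; eauto. }
  clear H. destruct H' as [m H]. unfold slope_test in H.
  set (gap := ssub _ val_one) in H.
  set (w := (weight F1 + weight F2 + weight F3)%Z) in H.
  assert (Hgap : valR gap = valR (reduced_min m F1) + valR (reduced_min m F2) +
                   valR (reduced_min m F3) + slopeR m * (x + y + z) - 1).
  { unfold gap. rewrite valR_sub, !valR_add, valR_mul, posR_f_plus, valR_one, Hk. ring. }
  destruct (reduced_min_le m F1 x Hx) as [A1 B1].
  destruct (reduced_min_le m F2 y Hy) as [A2 B2].
  destruct (reduced_min_le m F3 z Hz) as [A3 B3].
  rewrite <- (pi_face F1 x H1 Hx) in A1, B1.
  rewrite <- (pi_face F2 y H2 Hy) in A2, B2.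
  rewrite <- (pi_face F3 z H3 Hz) in A3, B3.
  assert (W1 := weight_sound p F1 x Hp H1 Hx).
  assert (W2 := weight_sound p F2 y Hp H2 Hy).
  assert (W3 := weight_sound p F3 z Hp H3 Hz).
  assert (Hw : IZR w = IZR (weight F1) + IZR (weight F2) + IZR (weight F3))
    by (unfold w; now rewrite !plus_IZR).
  assert (Hwpos : 0 <= IZR (weight F1) * s /\ 0 <= IZR (weight F2) * s /\
                  0 <= IZR (weight F3) * s).
  { assert (Q1 := Rabs_pos (extend p x)). assert (Q2 := Rabs_pos (extend p y)).
    assert (Q3 := Rabs_pos (extend p z)). split; [lra | split; lra]. }
  apply Rabs_le_between in W1. apply Rabs_le_between in W2.
  apply Rabs_le_between in W3.
  assert (Hgap' : valR (ssub gap (smul w val_s)) = valR gap - IZR w * s).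
  { rewrite valR_sub. unfold valR at 2. rewrite surdR_mul.
    unfold Rdiv. rewrite Rmult_assoc. fold (surdR val_s / IZR val_den).
    fold (valR val_s). now rewrite valR_s. }
  rewrite Hw in Hgap'. unfold dichotomy.
  apply orb_true_iff in H as [H|H]; [apply orb_true_iff in H as [H|H] |].
  - apply andb_true_iff in H as [H H']. apply valR_ge0 in H'. left.
    split; [lra |]. apply orb_true_iff in H as [H|H].
    + apply Z.eqb_eq in H. rewrite H in Hw.
      assert (Hw0 : (IZR (weight F1) + IZR (weight F2) + IZR (weight F3)) * s = 0)
        by (rewrite <- Hw; apply Rmult_0_l).
      lra.
    + now apply (balanced_sound p F1 F2 F3 k).
  - apply valR_gt0 in H. right. split; lra.
  - apply andb_true_iff in H as [H H']. apply valR_ge0 in H'. right.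
    assert (valR gap < pi x + pi y + pi z - 1); [| split; lra].
    apply orb_true_iff in H as [H|H]; [apply orb_true_iff in H as [H|H] |];
      [apply B1 in H | apply B2 in H | apply B3 in H]; lra.
Qed.

(** ** The finite check *)

Fixpoint tails {A : Type} (L : list A) (test : A -> list A -> bool) : bool :=
  match L with
  | [] => true
  | a :: L' => if test a L then tails L' test else false
  end.

Lemma tails_sound : forall (A : Type) (d : A) test L i,
  tails L test = true -> (i < length L)%nat ->
  test (nth i L d) (skipn i L) = true.
Proof.
  intros A d test L. induction L as [|b L IH]; simpl; intros i H Hi; [lia |].
  destruct (test b (b :: L)) eqn:Hb; [| discriminate].
  destruct i as [|i]; simpl; [exact Hb | apply IH; [exact H | lia]].
Qed.

(** A face that contains all of [[0, 1)]; it discards the [k] that no third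
    summand can reach. *)
Definition unit_face : face := Face true (-1, 0)%Z pos_one (0, 0)%Z 0.

(** As the condition is symmetric in the three faces, only triples in the order
    of the list are tested. *)
Definition check_triples (L : list face) : bool :=
  tails L (fun F1 L1 => tails L1 (fun F2 L2 =>
    forallb (fun k =>
      if infeasible F1 F2 unit_face k then true
      else forallb (fun F3 => triple_test F1 F2 F3 k) L2) [0; 1; 2]%Z)).

Lemma check_triples_sound : forall L i j n k,
  check_triples L = true -> (i <= j <= n)%nat -> (n < length L)%nat ->
  In k [0; 1; 2]%Z ->
  infeasible (nth i L no_face) (nth j L no_face) unit_face k = true \/
  triple_test (nth i L no_face) (nth j L no_face) (nth n L no_face) k = true.
Proof.
  intros L i j n k H Hij Hn Hk. unfold check_triples in H.
  apply (tails_sound _ no_face _ _ i) in H; [| lia].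
  apply (tails_sound _ no_face _ _ (j - i)) in H; [| rewrite length_skipn; lia].
  rewrite nth_skipn, skipn_skipn in H.
  replace (i + (j - i))%nat with j in H by lia.
  replace (j - i + i)%nat with j in H by lia.
  rewrite forallb_forall in H. specialize (H k Hk).
  destruct (infeasible _ _ unit_face k); [now left | right].
  rewrite forallb_forall in H. apply H.
  replace (nth n L no_face) with (nth (n - j) (skipn j L) no_face).
  - apply nth_In. rewrite length_skipn. lia.
  - rewrite nth_skipn. f_equal. lia.
Qed.

Lemma dichotomy_swap12 : forall p x y z, dichotomy p x y z -> dichotomy p y x z.
Proof. intros p x y z. unfold dichotomy. lra. Qed.

Lemma dichotomy_swap23 : forall p x y z, dichotomy p x y z -> dichotomy p x z y.
Proof. intros p x y z. unfold dichotomy. lra. Qed.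

Lemma check_triples_faces : check_triples face_list = true.
Proof. vm_cast_no_check (eq_refl true). Qed.

Lemma unit_face_contains : forall x, 0 <= x < 1 -> in_face unit_face x.
Proof.
  intros x Hx. unfold in_face. cbn [fopen flo fhi unit_face]. rewrite posR_one.
  unfold posR, surdR; simpl.
  assert (- 1 / IZR pos_den < 0); [| lra].
  assert (H := Rinv_0_lt_compat _ (proj1 dens_pos)). lra.
Qed.

Lemma dichotomy_sorted : forall p i j n k x y z, perturbation p ->
  (i <= j <= n)%nat -> (n < length face_list)%nat ->
  in_face (nth i face_list no_face) x -> in_face (nth j face_list no_face) y ->
  in_face (nth n face_list no_face) z -> x + y + z = f + IZR k ->
  dichotomy p x y z.
Proof.
  intros p i j n k x y z Hp Hij Hn Hx Hy Hz Hk.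
  assert (HF : forall m, (m < length face_list)%nat ->
                 In (nth m face_list no_face) faces)
    by (intros m Hm; now apply (nth_In face_list)).
  assert (Bx := proj1 (pi_unit_face _ x (HF i ltac:(lia)) Hx)).
  assert (By := proj1 (pi_unit_face _ y (HF j ltac:(lia)) Hy)).
  assert (Bz := proj1 (pi_unit_face _ z (HF n ltac:(lia)) Hz)).
  assert (Hk' : In k [0; 1; 2]%Z).
  { assert (-1 < k < 3)%Z; [| simpl; lia].
    split; apply lt_IZR; unfold f in Hk; lra. }
  destruct (check_triples_sound face_list i j n k check_triples_faces
              Hij Hn Hk') as [H|H].
  - rewrite (infeasible_sound _ _ _ k x y z) in H; try discriminate; auto.
    + apply faces_well_formed, HF. lia.
    + apply faces_well_formed, HF. lia.
    + now apply unit_face_contains.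
  - apply (triple_test_sound p _ _ _ k x y z Hp) in H; auto; apply HF; lia.
Qed.

Lemma dichotomy_unit : forall p k x y z, perturbation p ->
  0 <= x < 1 -> 0 <= y < 1 -> 0 <= z < 1 -> x + y + z = f + IZR k ->
  dichotomy p x y z.
Proof.
  intros p k x y z Hp Hx Hy Hz Hk.
  assert (Hn : forall w, 0 <= w < 1 -> exists i, (i < length face_list)%nat /\
                 in_face (nth i face_list no_face) w).
  { intros w Hw. destruct (faces_cover w Hw) as [F [HF HFw]].
    destruct (In_nth face_list F no_face HF) as [i [Hi E]].
    exists i. now rewrite E. }
  destruct (Hn x Hx) as [i [Hi Hix]]. destruct (Hn y Hy) as [j [Hj Hjy]].
  destruct (Hn z Hz) as [n [Hn' Hnz]].
  assert (S := fun a b c => dichotomy_sorted p a b c k).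
  destruct (Nat.le_ge_cases i j), (Nat.le_ge_cases j n), (Nat.le_ge_cases i n).
  - apply (S i j n); auto.
  - apply (S i j n); auto.
  - apply dichotomy_swap23. apply (S i n j); auto; lra.
  - apply dichotomy_swap23, dichotomy_swap12. apply (S n i j); auto; lra.
  - apply dichotomy_swap12. apply (S j i n); auto; lra.
  - apply dichotomy_swap12, dichotomy_swap23. apply (S j n i); auto; lra.
  - apply dichotomy_swap12, dichotomy_swap23, dichotomy_swap12.
    apply (S n j i); auto; lra.
  - apply dichotomy_swap12, dichotomy_swap23, dichotomy_swap12.
    apply (S n j i); auto; lra.
Qed.

Definition perturbed (p : R -> R) (x : R) : R := pi x + extend p (frac_part x).

Lemma frac_part_shift : forall x, exists k : Z, frac_part x = x + IZR k.
Proof. intros x. exists (- Int_part x)%Z. unfold frac_part. rewrite opp_IZR. ring. Qed.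

Lemma frac_part_unit : forall x, 0 <= frac_part x < 1.
Proof. intros x. destruct (base_fp x). lra. Qed.

Lemma pi_frac_part : forall x, pi (frac_part x) = pi x.
Proof.
  intros x. unfold pi. now rewrite (frac_part_id (frac_part x) (frac_part_unit x)).
Qed.

Lemma dichotomy_real : forall p x y z, perturbation p -> congr_f (x + y + z) ->
  dichotomy p (frac_part x) (frac_part y) (frac_part z).
Proof.
  intros p x y z Hp [k Hk].
  destruct (frac_part_shift x) as [a Ha]. destruct (frac_part_shift y) as [b Hb].
  destruct (frac_part_shift z) as [c Hc].
  apply (dichotomy_unit p (k + a + b + c)); auto using frac_part_unit.
  rewrite !plus_IZR. lra.
Qed.

Lemma perturbed_three_term : forall p, perturbation p -> three_term (perturbed p).
Proof.
  intros p Hp x y z H. apply (dichotomy_real p) in H; [| exact Hp].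
  unfold dichotomy in H. rewrite !pi_frac_part in H. unfold perturbed. lra.
Qed.

Lemma perturbed_tight_triple : forall p x y z, perturbation p -> congr_f (x + y + z) ->
  perturbed p x + perturbed p y + perturbed p z = 1 <-> pi x + pi y + pi z = 1.
Proof.
  intros p x y z Hp H. apply (dichotomy_real p) in H; [| exact Hp].
  unfold dichotomy in H. rewrite !pi_frac_part in H. unfold perturbed. lra.
Qed.

(** * Additive triples of faces *)

(** [pi x + pi y + pi z] is constant on a triple of faces when all open faces
    among them have the same slope. *)
Definition common_slope (F1 F2 F3 : face) : Z :=
  if fopen F1 then fslope F1 else if fopen F2 then fslope F2 else fslope F3.

Definition additive (F1 F2 F3 : face) (k : Z) : bool :=
  let m := common_slope F1 F2 F3 in
  negb (steep m F1) && negb (steep m F2) && negb (steep m F3) &&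
  seqb (sadd (sadd (fval F1) (sadd (fval F2) (fval F3)))
             (smul m (ssub (pos_f_plus k)
                           (sadd (flo F1) (sadd (flo F2) (flo F3)))))) val_one.

Lemma face_fun_not_steep : forall m F x, in_face F x -> steep m F = false ->
  face_fun F x = valR (fval F) + slopeR m * (x - posR (flo F)).
Proof.
  intros m F x Hx H. unfold in_face in Hx. unfold face_fun, steep in *.
  destruct (fopen F); simpl in H.
  - apply negb_false_iff, Z.eqb_eq in H. now rewrite H.
  - rewrite Hx. ring.
Qed.

Lemma additive_sound : forall F1 F2 F3 k x y z,
  In F1 faces -> In F2 faces -> In F3 faces ->
  in_face F1 x -> in_face F2 y -> in_face F3 z ->
  additive F1 F2 F3 k = true -> x + y + z = f + IZR k ->
  pi x + pi y + pi z = 1.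
Proof.
  intros F1 F2 F3 k x y z H1 H2 H3 Hx Hy Hz H Hk. unfold additive in H.
  set (m := common_slope F1 F2 F3) in H.
  apply andb_true_iff in H as [H E]. apply andb_true_iff in H as [H S3].
  apply andb_true_iff in H as [S1 S2]. apply negb_true_iff in S1, S2, S3.
  apply seqb_sound, (f_equal valR) in E.
  rewrite !valR_add, valR_mul, posR_sub, !posR_add, posR_f_plus, valR_one in E.
  rewrite (pi_face F1 x), (pi_face F2 y), (pi_face F3 z) by assumption.
  rewrite (face_fun_not_steep m F1 x), (face_fun_not_steep m F2 y),
    (face_fun_not_steep m F3 z) by assumption.
  rewrite <- Hk in E. lra.
Qed.

(** The sums of a point of [F2] and one of [F3] form an open interval, or a single
    number if both faces are points; [f + k - x] has to be in it for all [x] in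
    [F1]. *)
Definition completable (F1 F2 F3 : face) (k : Z) : bool :=
  let lo := sadd (flo F2) (flo F3) in
  let hi := sadd (fhi F2) (fhi F3) in
  let c := pos_f_plus k in
  if fopen F2 || fopen F3 then
    if fopen F1
    then sge0 (ssub (ssub c (fhi F1)) lo) && sge0 (ssub hi (ssub c (flo F1)))
    else sgt0 (ssub (ssub c (flo F1)) lo) && sgt0 (ssub hi (ssub c (flo F1)))
  else negb (fopen F1) && seqb (ssub c (flo F1)) lo.

Lemma completable_sound : forall F1 F2 F3 k x,
  In F2 faces -> In F3 faces -> in_face F1 x ->
  completable F1 F2 F3 k = true ->
  exists y z, in_face F2 y /\ in_face F3 z /\ x + y + z = f + IZR k.
Proof.
  intros F1 F2 F3 k x H2 H3 Hx H. unfold completable in H.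
  apply faces_well_formed in H2, H3. unfold well_formed in H2, H3.
  assert (W : if fopen F2 || fopen F3
    then posR (sadd (flo F2) (flo F3)) < f + IZR k - x < posR (sadd (fhi F2) (fhi F3))
    else f + IZR k - x = posR (sadd (flo F2) (flo F3))).
  { unfold in_face in Hx. destruct (fopen F2 || fopen F3), (fopen F1);
      apply andb_true_iff in H as [H H'].
    - apply posR_le in H, H'. rewrite posR_sub, posR_f_plus in H, H'. lra.
    - apply posR_lt in H, H'. rewrite posR_sub, posR_f_plus in H, H'. lra.
    - discriminate.
    - apply seqb_sound in H'. rewrite <- H', posR_sub, posR_f_plus. lra. }
  rewrite !posR_add in W. set (w := f + IZR k - x) in W.
  unfold in_face. destruct (fopen F2), (fopen F3); cbn [orb] in W.
  - apply posR_lt in H2, H3.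
    set (a := Rmax (posR (flo F2)) (w - posR (fhi F3))).
    set (b := Rmin (posR (fhi F2)) (w - posR (flo F3))).
    assert (Hab : a < b).
    { unfold a, b. apply Rmax_lub_lt; apply Rmin_glb_lt; lra. }
    assert (Ha1 : posR (flo F2) <= a) by apply Rmax_l.
    assert (Ha2 : w - posR (fhi F3) <= a) by apply Rmax_r.
    assert (Hb1 : b <= posR (fhi F2)) by apply Rmin_l.
    assert (Hb2 : b <= w - posR (flo F3)) by apply Rmin_r.
    exists ((a + b) / 2), (w - (a + b) / 2). unfold w in *. lra.
  - apply seqb_sound in H3. rewrite <- H3 in W.
    exists (w - posR (flo F3)), (posR (flo F3)). unfold w in *. lra.
  - apply seqb_sound in H2. rewrite <- H2 in W.
    exists (posR (flo F2)), (w - posR (flo F2)). unfold w in *. lra.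
  - exists (posR (flo F2)), (posR (flo F3)). unfold w in *. lra.
Qed.

Lemma pt_faces : forall i, (i < 40)%nat -> In (pt i) faces.
Proof.
  intros i Hi. apply (nth_In face_list).
  change (length face_list) with 80%nat. lia.
Qed.

Lemma iv_faces : forall i, (i < 40)%nat -> In (iv i) faces.
Proof.
  intros i Hi. apply (nth_In face_list).
  change (length face_list) with 80%nat. lia.
Qed.

(** * [pi] and its perturbations are valid *)

Lemma in_pt0 : in_face (pt 0) 0.
Proof. unfold in_face; simpl. now rewrite posR_zero. Qed.

Lemma pi_0 : pi 0 = 0.
Proof.
  rewrite (pi_face (pt 0) 0) by ((apply pt_faces; lia) || apply in_pt0).
  unfold face_fun, valR, surdR; simpl. rewrite posR_zero. unfold Rdiv. ring.
Qed.

(** The reflections [x |-> f - x] of [[0, f]] and [x |-> f + 1 - x] of [(f, 1)]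
    reverse the order of the faces. *)
Definition reflected_pairs (L : list face) : list (face * face) := combine L (rev L).

Definition symmetric_test (k : Z) (F : face * face) : bool :=
  additive (pt 0) (fst F) (snd F) k && completable (fst F) (pt 0) (snd F) k.

Lemma pi_symmetric_unit : forall x, 0 <= x < 1 ->
  exists y (k : Z), 0 <= y < 1 /\ x + y = f + IZR k /\ pi x + pi y = 1.
Proof.
  assert (Hgen : forall L k, incl L faces ->
    forallb (symmetric_test k) (reflected_pairs L) = true ->
    forall F x, In F L -> in_face F x ->
    exists y, 0 <= y < 1 /\ x + y = f + IZR k /\ pi x + pi y = 1).
  { intros L k HL H F x HF Hx. rewrite forallb_forall in H.
    destruct (In_nth L F no_face HF) as [i [Hi E]].
    set (G := nth i (rev L) no_face).
    assert (HG : In G faces).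
    { apply HL, in_rev, nth_In. now rewrite length_rev. }
    assert (Hpair : In (F, G) (reflected_pairs L)).
    { unfold reflected_pairs. rewrite <- E. unfold G.
      rewrite <- combine_nth by now rewrite length_rev.
      apply nth_In. rewrite length_combine, length_rev. lia. }
    specialize (H _ Hpair). apply andb_true_iff in H as [H H']. simpl in H, H'.
    assert (H0 : In (pt 0) faces) by (apply pt_faces; lia).
    destruct (completable_sound F (pt 0) G k x H0 HG Hx H') as [z [y [Hz [Hy Hk]]]].
    assert (Hz0 : z = 0).
    { unfold in_face in Hz; simpl in Hz. now rewrite posR_zero in Hz. }
    subst z. exists y. split; [exact (proj1 (pi_unit_face G y HG Hy)) |].
    split; [lra |].
    assert (E1 := additive_sound (pt 0) F G k 0 x y H0 (HL F HF) HG in_pt0 Hx Hy H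
                    ltac:(lra)).
    rewrite pi_0 in E1. lra. }
  intros x Hx. destruct (faces_cover x Hx) as [F [HF HFx]].
  assert (I1 : incl (firstn 75 faces) faces) 
    by (intros G HG; rewrite <- (firstn_skipn 75 faces); apply in_app_iff; auto).
  assert (I2 : incl (skipn 75 faces) faces) 
    by (intros G HG; rewrite <- (firstn_skipn 75 faces); apply in_app_iff; auto).
  assert (C1 : forallb (symmetric_test 0) (reflected_pairs (firstn 75 faces)) = true)
    by (vm_compute; reflexivity).
  assert (C2 : forallb (symmetric_test 1) (reflected_pairs (skipn 75 faces)) = true)
    by (vm_compute; reflexivity).
  rewrite <- (firstn_skipn 75 faces) in HF. apply in_app_iff in HF as [HF|HF].
  - destruct (Hgen _ 0%Z I1 C1 F x HF HFx) as [y Hy]. eauto.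
  - destruct (Hgen _ 1%Z I2 C2 F x HF HFx) as [y Hy]. eauto.
Qed.

Lemma pi_symmetric : symmetric pi.
Proof.
  intros x y [k Hk]. rewrite <- (pi_frac_part x), <- (pi_frac_part y).
  destruct (pi_symmetric_unit _ (frac_part_unit x)) as [z [m [Hz [Hm E]]]].
  replace (frac_part y) with z; [exact E |].
  destruct (frac_part_shift x) as [a Ha]. destruct (frac_part_shift y) as [b Hb].
  assert (B := frac_part_unit y).
  assert (D : z = frac_part y + IZR (m - k - a - b)).
  { rewrite !minus_IZR. lra. }
  assert (D0 : (m - k - a - b = 0)%Z).
  { assert (-1 < m - k - a - b < 1)%Z; [| lia]. split; apply lt_IZR; lra. }
  rewrite D0 in D. lra.
Qed.

Lemma extend_0 : forall p, extend p 0 = 0.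
Proof. intros p. apply extend_outside; unfold l, u, f; lra. Qed.

Lemma frac_part_0 : frac_part 0 = 0.
Proof. apply frac_part_id. lra. Qed.

Lemma perturbed_0 : forall p, perturbed p 0 = 0.
Proof. intros p. unfold perturbed. rewrite frac_part_0, extend_0, pi_0. ring. Qed.

Lemma perturbed_symmetric : forall p, perturbation p -> symmetric (perturbed p).
Proof.
  intros p Hp x y Hxy. assert (E := pi_symmetric x y Hxy).
  assert (E' := proj2 (perturbed_tight_triple p x y 0 Hp ltac:(now rewrite Rplus_0_r))).
  rewrite perturbed_0, pi_0 in E'. lra.
Qed.

Lemma pi_ge_weight : forall F x, In F faces -> in_face F x -> IZR (weight F) * s <= pi x.
Proof.
  intros F x HF Hx.
  assert (H : forallb (fun F => sge0 (ssub (reduced_min 0 F) (smul (weight F) val_s)))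
                faces = true) by (vm_compute; reflexivity).
  rewrite forallb_forall in H. specialize (H F HF). apply valR_ge0 in H.
  rewrite valR_sub in H. unfold valR at 2 in H. rewrite surdR_mul in H.
  unfold Rdiv in H. rewrite Rmult_assoc in H. fold (surdR val_s / IZR val_den) in H.
  fold (valR val_s) in H. rewrite valR_s in H.
  destruct (reduced_min_le 0 F x Hx) as [H' _].
  rewrite (pi_face F x HF Hx). unfold slopeR, Rdiv in H'. lra.
Qed.

Lemma perturbed_ge0 : forall p x, perturbation p -> 0 <= perturbed p x.
Proof.
  intros p x Hp. unfold perturbed. rewrite <- pi_frac_part.
  destruct (faces_cover _ (frac_part_unit x)) as [F [HF Hx]].
  assert (H1 := pi_ge_weight F _ HF Hx).
  assert (H2 := weight_sound p F _ Hp HF Hx). apply Rabs_le_between in H2. lra.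
Qed.

Theorem perturbed_valid : forall p, perturbation p -> valid (perturbed p).
Proof.
  intros p Hp. apply valid_of_three_term.
  - intros x. now apply perturbed_ge0.
  - apply perturbed_0.
  - now apply perturbed_symmetric.
  - now apply perturbed_three_term.
Qed.

Theorem perturbed_tight : forall p q, perturbation p -> perturbation q ->
  forall y, tight (perturbed p) y -> tight (perturbed q) y.
Proof.
  intros p q Hp Hq. apply tight_of_tight_triples;
    auto using perturbed_0, perturbed_symmetric, perturbed_three_term.
  intros x y z Hxyz H. apply perturbed_tight_triple; auto.
  now apply (perturbed_tight_triple p).
Qed.

(** * The difference of [pi] and a function tight wherever [pi] is *)

(** The relations satisfied by [g - pi] when [g] is valid and tight wherever
    [pi] is. *)
Record tight_difference (phi : R -> R) : Prop := {
  td_bounded : forall x, Rabs (phi x) <= 1;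
  td_odd : forall x y, congr_f (x + y) -> phi x + phi y = 0;
  td_additive : forall x y z, congr_f (x + y + z) ->
    pi x + pi y + pi z = 1 -> phi x + phi y + phi z = 0 }.

Lemma symmetric_le_1 : forall g, (forall x, 0 <= g x) -> symmetric g ->
  forall x, g x <= 1.
Proof.
  intros g H0 Hs x. assert (E := Hs x (f - x) ltac:(exists 0%Z; simpl; lra)).
  specialize (H0 (f - x)). lra.
Qed.

Lemma perturbation_0 : perturbation (fun _ => 0).
Proof.
  intros x Hx. split; [rewrite Rabs_R0; unfold s; lra | intros; lra].
Qed.

Lemma perturbed_0_pi : forall x, perturbed (fun _ => 0) x = pi x.
Proof.
  intros x. unfold perturbed, extend.
  repeat match goal with |- context [if ?c then _ else _] => destruct c end; lra.
Qed.

Lemma tight_difference_of_valid : forall g, valid g ->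
  (forall y, tight (perturbed (fun _ => 0)) y -> tight g y) ->
  tight_difference (fun x => g x - pi x).
Proof.
  intros g Hg Ht.
  assert (Hs : symmetric g).
  { apply symmetric_of_tight with (2 := Ht). apply perturbed_symmetric, perturbation_0. }
  assert (Hg0 := proj1 Hg). assert (Hg1 := symmetric_le_1 g Hg0 Hs).
  assert (Hp0 : forall x, 0 <= pi x).
  { intros x. rewrite <- perturbed_0_pi. apply perturbed_ge0, perturbation_0. }
  assert (Hp1 := symmetric_le_1 pi Hp0 pi_symmetric).
  split.
  - intros x. apply Rabs_le. specialize (Hg0 x). specialize (Hg1 x).
    specialize (Hp0 x). specialize (Hp1 x). lra.
  - intros x y H. assert (E1 := Hs x y H). assert (E2 := pi_symmetric x y H). lra.
  - intros x y z H E. assert (E' := tight_triple _ _ Ht x y z H).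
    rewrite !perturbed_0_pi in E'. specialize (E' E). lra.
Qed.

Lemma td_zero : forall phi, tight_difference phi -> phi 0 = 0 /\ phi f = 0.
Proof.
  intros phi H.
  assert (E1 := td_odd phi H 0 f ltac:(exists 0%Z; simpl; lra)).
  assert (C : congr_f (0 + f)) by (exists 0%Z; simpl; lra).
  assert (Ef := pi_symmetric 0 f C). rewrite pi_0 in Ef.
  assert (C' : congr_f (0 + 0 + f)) by (exists 0%Z; simpl; lra).
  assert (E2 := td_additive phi H 0 0 f C'). rewrite pi_0 in E2. lra.
Qed.

Lemma td_faces : forall phi F1 F2 F3 k x y z, tight_difference phi ->
  additive F1 F2 F3 k = true ->
  In F1 faces -> In F2 faces -> In F3 faces ->
  in_face F1 x -> in_face F2 y -> in_face F3 z -> x + y + z = f + IZR k ->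
  phi x + phi y + phi z = 0.
Proof.
  intros phi F1 F2 F3 k x y z H Hadd H1 H2 H3 Hx Hy Hz Hk.
  apply (td_additive phi H); [now exists k |].
  now apply (additive_sound F1 F2 F3 k).
Qed.

Ltac solve_face :=
  match goal with
  | |- In (pt _) faces => apply pt_faces; lia
  | |- In (iv _) faces => apply iv_faces; lia
  end.

Ltac solve_in_face :=
  match goal with |- in_face ?F ?x =>
    let v := eval vm_compute in F in change (in_face v x);
    unfold in_face, posR, surdR, pos_den; simpl; lra
  end.

Ltac additive_at H F1 F2 F3 k x y z E :=
  match type of H with tight_difference ?phi =>
    assert (E : phi x + phi y + phi z = 0);
    [ apply (td_faces phi F1 F2 F3 k);
      [ exact H
      | vm_compute; reflexivity
      | solve_face | solve_face | solve_face
      | solve_in_face | solve_in_face | solve_in_face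
      | unfold f; simpl; lra ]
    |]
  end.

(** ** Two seeds from the interval lemma *)

(** The triples in [iv 1], [iv 1], [iv 35] are additive, and [iv 35] is the mirror
    image of [iv 1]; by oddness this is Cauchy's equation on a triangle. *)
Lemma td_iv1_linear : forall phi, tight_difference phi ->
  exists m, forall x, 101 / 5000 < x < 60153 / 369200 -> phi x = m * x.
Proof.
  intros phi H. apply cauchy_triangle with (C := 1); try lra.
  - intros x _. now apply td_bounded.
  - intros x y Hx Hy Hxy.
    additive_at H (iv 1) (iv 1) (iv 35) 0%Z x y (4 / 5 - (x + y)) E.
    assert (E' := td_odd phi H (x + y) (4 / 5 - (x + y))
                    ltac:(exists 0%Z; unfold f; simpl; lra)). lra.
Qed.

(** With [w = 1 - x] the additive triples in [iv 38] also form a Cauchy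
    triangle; the linear solution is odd about [w = 1 / 10] only if it is [0]. *)
Lemma td_iv38_zero : forall phi, tight_difference phi ->
  forall x, 4101 / 5000 < x < 4899 / 5000 -> phi x = 0.
Proof.
  intros phi H.
  assert (Hodd : forall w, phi (1 - w) + phi (4 / 5 + w) = 0).
  { intros w. apply (td_odd phi H). exists 1%Z. unfold f. lra. }
  destruct (cauchy_triangle (fun w => phi (1 - w)) (101 / 5000) (899 / 5000) 1)
    as [m Hm]; try lra.
  - intros x _. now apply td_bounded.
  - intros x y Hx Hy Hxy.
    additive_at H (iv 38) (iv 38) (iv 38) 2%Z (1 - x) (1 - y) (4 / 5 + (x + y)) E.
    specialize (Hodd (x + y)). lra.
  - cbv beta in Hm. assert (Hm0 : m = 0).
    { assert (E1 := Hm (1 / 10) ltac:(lra)). specialize (Hodd (1 / 10)).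
      replace (4 / 5 + 1 / 10) with (1 - 1 / 10) in Hodd by lra. lra. }
    intros x Hx. replace x with (1 - (1 - x)) by ring. rewrite Hm by lra.
    rewrite Hm0. ring.
Qed.

Definition zero_on (phi : R -> R) (F : face) : Prop :=
  forall x, in_face F x -> phi x = 0.

Lemma zero_on_pt : forall phi F, fopen F = false -> phi (posR (flo F)) = 0 -> zero_on phi F.
Proof. intros phi F HF H x Hx. unfold in_face in Hx. rewrite HF in Hx. now subst x. Qed.

(** Everything is first expressed by the slope [m] on [iv 1] and a few values at
    breakpoints, each step using one additive triple.  The value at
    [pt 6] comes out in two ways, through [pt 28] and through [pt 35], as different
    multiples of [m]; so [m = 0]. *)
Lemma td_seeds : forall phi, tight_difference phi ->
  zero_on phi (iv 0) /\ zero_on phi (iv 1) /\ zero_on phi (iv 38) /\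
  zero_on phi (iv 39) /\ zero_on phi (pt 36) /\ zero_on phi (pt 38) /\
  zero_on phi (pt 13) /\ zero_on phi (pt 18) /\ zero_on phi (iv 18).
Proof.
  intros phi H.
  assert (H38 := td_iv38_zero phi H).
  destruct (td_iv1_linear phi H) as [m Hm].
  assert (H0 : forall x, 0 < x < 101 / 5000 -> phi x = - phi (4101 / 5000)).
  { intros x Hx.
    additive_at H (iv 0) (pt 38) (iv 38) 1%Z x (4101 / 5000) (4899 / 5000 - x) E.
    rewrite (H38 (4899 / 5000 - x)) in E by lra. lra. }
  additive_at H (iv 0) (iv 0) (pt 36) 0%Z (101 / 10000) (101 / 10000) (3899 / 5000) E36.
  rewrite H0 in E36 by lra.
  assert (H39 : forall z, 4899 / 5000 < z < 1 ->
    phi z = - phi (3899 / 5000) - m * (5101 / 5000 - z)).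
  { intros z Hz.
    additive_at H (iv 1) (pt 36) (iv 39) 1%Z (5101 / 5000 - z) (3899 / 5000) z E.
    rewrite (Hm (5101 / 5000 - z)) in E by lra. lra. }
  additive_at H (pt 38) (iv 39) (iv 39) 2%Z (4101 / 5000) (9899 / 10000) (9899 / 10000) E38.
  rewrite (H39 (9899 / 10000)) in E38 by lra.
  additive_at H (iv 1) (pt 18) (pt 18) 0%Z (51 / 400) (269 / 800) (269 / 800) E18.
  rewrite (Hm (51 / 400)) in E18 by lra.
  assert (H18 : forall z, 269 / 800 < z < 21 / 50 ->
    phi z = - phi (269 / 800) - m * (371 / 800 - z)).
  { intros z Hz.
    additive_at H (iv 1) (pt 18) (iv 18) 0%Z (371 / 800 - z) (269 / 800) z E.
    rewrite (Hm (371 / 800 - z)) in E by lra. lra. }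
  additive_at H (pt 13) (pt 13) (iv 18) 0%Z (14199 / 64600) (14199 / 64600)
    (4 / 5 - 2 * (14199 / 64600)) E13.
  rewrite (H18 (4 / 5 - 2 * (14199 / 64600))) in E13 by lra.
  additive_at H (pt 13) (pt 28) (iv 39) 1%Z (14199 / 64600) (110681 / 184600)
    (9 / 5 - 14199 / 64600 - 110681 / 184600) E28.
  rewrite (H39 (9 / 5 - 14199 / 64600 - 110681 / 184600)) in E28 by lra.
  additive_at H (iv 0) (pt 6) (pt 28) 0%Z (4 / 5 - 19 / 100 - 110681 / 184600) (19 / 100)
    (110681 / 184600) E6.
  rewrite (H0 (4 / 5 - 19 / 100 - 110681 / 184600)) in E6 by lra.
  additive_at H (iv 1) (iv 1) (pt 35) 0%Z ((4 / 5 - 235207 / 369200) / 2)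
    ((4 / 5 - 235207 / 369200) / 2) (235207 / 369200) E35.
  rewrite (Hm ((4 / 5 - 235207 / 369200) / 2)) in E35 by lra.
  additive_at H (pt 6) (pt 35) (iv 38) 1%Z (19 / 100) (235207 / 369200)
    (9 / 5 - 19 / 100 - 235207 / 369200) E6'.
  rewrite (H38 (9 / 5 - 19 / 100 - 235207 / 369200)) in E6' by lra.
  assert (Hm0 : m = 0) by lra. subst m.
  assert (V38 : phi (4101 / 5000) = 0) by lra.
  assert (V36 : phi (3899 / 5000) = 0) by lra.
  assert (V18 : phi (269 / 800) = 0) by lra.
  assert (V13 : phi (14199 / 64600) = 0) by lra.
  repeat split; first
    [ intros x Hx; unfold in_face, posR, surdR, pos_den in Hx; simpl in Hx
    | apply zero_on_pt; [reflexivity |] ].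
  - rewrite H0; lra.
  - rewrite Hm; lra.
  - apply H38; lra.
  - rewrite H39; lra.
  - rewrite <- V36. f_equal. unfold posR, surdR, pos_den; simpl. lra.
  - rewrite <- V38. f_equal. unfold posR, surdR, pos_den; simpl. lra.
  - rewrite <- V13. f_equal. unfold posR, surdR, pos_den; simpl. lra.
  - rewrite <- V18. f_equal. unfold posR, surdR, pos_den; simpl. lra.
  - destruct (Rlt_le_dec x (21 / 50)) as [Hx'|Hx'].
    + rewrite H18; lra.
    + assert (E := td_odd phi H x (4 / 5 - x) ltac:(exists 0%Z; unfold f; simpl; lra)).
      rewrite (H18 (4 / 5 - x)) in E by lra. lra.
Qed.

(** ** Propagation to all other faces *)

Lemma zero_on_third : forall phi F1 F2 F3 k, tight_difference phi ->
  In F1 faces -> In F2 faces -> In F3 faces ->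
  additive F1 F2 F3 k = true -> completable F1 F2 F3 k = true ->
  zero_on phi F2 -> zero_on phi F3 -> zero_on phi F1.
Proof.
  intros phi F1 F2 F3 k H H1 H2 H3 Ha Hc Z2 Z3 x Hx.
  destruct (completable_sound F1 F2 F3 k x H2 H3 Hx Hc) as [y [z [Hy [Hz Hk]]]].
  assert (E := td_faces phi F1 F2 F3 k x y z H Ha H1 H2 H3 Hx Hy Hz Hk).
  rewrite (Z2 y Hy), (Z3 z Hz) in E. lra.
Qed.

Definition pt_no (i : nat) : nat := 2 * i.
Definition iv_no (i : nat) : nat := 2 * i + 1.

Definition step : Type := (nat * nat * nat * Z)%type.

(** A step [(a, b, c, k)] derives that the function vanishes on face [a] from the
    same fact for the faces [b] and [c]. *)
Fixpoint propagate (known : list nat) (steps : list step) : option (list nat) :=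
  match steps with
  | [] => Some known
  | (a, b, c, k) :: steps' =>
      let F := fun i => nth i face_list no_face in
      if existsb (Nat.eqb b) known && existsb (Nat.eqb c) known &&
         (a <? 80)%nat &&
         additive (F a) (F b) (F c) k && completable (F a) (F b) (F c) k
      then propagate (a :: known) steps'
      else None
  end.

Lemma propagate_sound : forall phi steps known known', tight_difference phi ->
  (forall i, In i known -> (i < 80)%nat /\ zero_on phi (nth i face_list no_face)) ->
  propagate known steps = Some known' ->
  forall i, In i known' -> zero_on phi (nth i face_list no_face).
Proof.
  intros phi steps. induction steps as [|[[[a b] c] k] steps IH];
    intros known known' H Hknown E; simpl in E.
  - injection E as <-. intros i Hi. now apply Hknown.
  - destruct (_ && _) eqn:T in E; [| discriminate].
    apply andb_true_iff in T as [T T5]. apply andb_true_iff in T as [T T4].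
    apply andb_true_iff in T as [T T3]. apply andb_true_iff in T as [T1 T2].
    apply Nat.ltb_lt in T3.
    apply existsb_exists in T1 as [b' [Hb E1]]. apply Nat.eqb_eq in E1. subst b'.
    apply existsb_exists in T2 as [c' [Hc E2]]. apply Nat.eqb_eq in E2. subst c'.
    destruct (Hknown b Hb) as [Lb Zb]. destruct (Hknown c Hc) as [Lc Zc].
    assert (Hin : forall i, (i < 80)%nat -> In (nth i face_list no_face) faces)
      by (intros i Hi; now apply (nth_In face_list)).
    refine (IH (a :: known) known' H _ E).
    intros i [<-|Hi]; [| now apply Hknown]. split; [exact T3 |].
    apply (zero_on_third phi _ (nth b face_list no_face) (nth c face_list no_face) k);
      auto.
Qed.

Definition seeds : list nat :=
  [pt_no 0; iv_no 0; iv_no 1; iv_no 38; iv_no 39; pt_no 36; pt_no 37; pt_no 38;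
   pt_no 13; pt_no 18; iv_no 18].

Definition steps : list step :=
  [
    (iv_no 35, pt_no 0, iv_no 1, 0%Z); (pt_no 1, pt_no 0, pt_no 36, 0%Z);
    (pt_no 24, pt_no 0, pt_no 13, 0%Z); (pt_no 19, pt_no 0, pt_no 18, 0%Z);
    (pt_no 39, pt_no 0, pt_no 38, 1%Z); (pt_no 22, iv_no 0, pt_no 13, 0%Z);
    (pt_no 10, iv_no 1, pt_no 22, 0%Z); (pt_no 11, iv_no 1, pt_no 22, 0%Z);
    (pt_no 20, iv_no 1, pt_no 13, 0%Z); (pt_no 16, iv_no 1, pt_no 20, 0%Z);
    (pt_no 30, pt_no 10, iv_no 39, 1%Z); (pt_no 33, pt_no 10, iv_no 38, 1%Z);
    (pt_no 28, pt_no 13, iv_no 39, 1%Z); (iv_no 36, pt_no 0, iv_no 0, 0%Z);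
    (iv_no 37, pt_no 0, iv_no 39, 1%Z); (iv_no 23, pt_no 10, iv_no 0, 0%Z);
    (iv_no 24, pt_no 10, iv_no 0, 0%Z); (iv_no 21, pt_no 13, iv_no 0, 0%Z);
    (pt_no 35, iv_no 1, iv_no 1, 0%Z); (iv_no 22, pt_no 10, iv_no 1, 0%Z);
    (iv_no 20, pt_no 13, iv_no 1, 0%Z); (iv_no 30, pt_no 10, iv_no 39, 1%Z);
    (iv_no 31, pt_no 10, iv_no 39, 1%Z); (iv_no 32, pt_no 10, iv_no 38, 1%Z);
    (iv_no 28, pt_no 13, iv_no 39, 1%Z); (iv_no 29, pt_no 13, iv_no 38, 1%Z);
    (pt_no 2, pt_no 0, pt_no 35, 0%Z); (pt_no 4, pt_no 0, pt_no 33, 0%Z);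
    (pt_no 7, pt_no 0, pt_no 30, 0%Z); (pt_no 9, pt_no 0, pt_no 28, 0%Z);
    (pt_no 27, pt_no 0, pt_no 10, 0%Z); (pt_no 26, pt_no 0, pt_no 11, 0%Z);
    (pt_no 15, pt_no 0, pt_no 22, 0%Z); (pt_no 21, pt_no 0, pt_no 16, 0%Z);
    (pt_no 17, pt_no 0, pt_no 20, 0%Z); (pt_no 6, iv_no 0, pt_no 28, 0%Z);
    (pt_no 29, iv_no 0, pt_no 6, 0%Z); (pt_no 25, iv_no 0, pt_no 10, 0%Z);
    (pt_no 3, iv_no 1, pt_no 30, 0%Z); (pt_no 23, iv_no 1, pt_no 6, 0%Z);
    (pt_no 32, pt_no 6, iv_no 39, 1%Z); (iv_no 4, pt_no 0, iv_no 32, 0%Z);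
    (iv_no 5, pt_no 0, iv_no 31, 0%Z); (iv_no 6, pt_no 0, iv_no 30, 0%Z);
    (iv_no 7, pt_no 0, iv_no 29, 0%Z); (iv_no 8, pt_no 0, iv_no 28, 0%Z);
    (iv_no 12, pt_no 0, iv_no 24, 0%Z); (iv_no 13, pt_no 0, iv_no 23, 0%Z);
    (iv_no 14, pt_no 0, iv_no 22, 0%Z); (iv_no 15, pt_no 0, iv_no 21, 0%Z);
    (iv_no 16, pt_no 0, iv_no 20, 0%Z); (iv_no 26, pt_no 6, iv_no 0, 0%Z);
    (iv_no 27, pt_no 6, iv_no 0, 0%Z); (iv_no 25, pt_no 6, iv_no 1, 0%Z);
    (iv_no 33, pt_no 6, iv_no 39, 1%Z); (iv_no 34, pt_no 6, iv_no 38, 1%Z);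
    (pt_no 34, pt_no 0, pt_no 3, 0%Z); (pt_no 5, pt_no 0, pt_no 32, 0%Z);
    (pt_no 31, pt_no 0, pt_no 6, 0%Z); (pt_no 8, pt_no 0, pt_no 29, 0%Z);
    (pt_no 12, pt_no 0, pt_no 25, 0%Z); (pt_no 14, pt_no 0, pt_no 23, 0%Z);
    (iv_no 2, pt_no 0, iv_no 34, 0%Z); (iv_no 3, pt_no 0, iv_no 33, 0%Z);
    (iv_no 9, pt_no 0, iv_no 27, 0%Z); (iv_no 10, pt_no 0, iv_no 26, 0%Z);
    (iv_no 11, pt_no 0, iv_no 25, 0%Z)
  ].

Lemma td_zero_on : forall phi i, tight_difference phi ->
  (i < 80)%nat -> i <> iv_no 17 -> i <> iv_no 19 -> zero_on phi (nth i face_list no_face).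
Proof.
  intros phi i H Hi H17 H19.
  assert (C : match propagate seeds steps with
              | Some known => forallb (fun j => Nat.eqb j (iv_no 17) || Nat.eqb j (iv_no 19)
                                || existsb (Nat.eqb j) known) (seq 0 80)
              | None => false
              end = true) by (vm_compute; reflexivity).
  destruct (propagate seeds steps) as [known|] eqn:E; [| discriminate].
  refine (propagate_sound phi steps seeds known H _ E i _).
  - destruct (td_seeds phi H) as [S0 [S1 [S2 [S3 [S4 [S5 [S6 [S7 S18]]]]]]]].
    destruct (td_zero phi H) as [Z0 Zf].
    assert (S8 : zero_on phi (pt 0)).
    { apply zero_on_pt; [reflexivity |]. 
      change (phi (posR (0, 0)%Z) = 0). now rewrite posR_zero. }
    assert (S9 : zero_on phi (pt 37)).
    { apply zero_on_pt; [reflexivity |]. rewrite <- posR_f in Zf. exact Zf. }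
    intros j Hj. unfold seeds in Hj. simpl in Hj.
    repeat (destruct Hj as [<-|Hj]; 
      [split; [apply Nat.ltb_lt; reflexivity | assumption] |]).
    destruct Hj.
  - rewrite forallb_forall in C. specialize (C i ltac:(apply in_seq; lia)).
    apply orb_true_iff in C as [C|C]; [apply orb_true_iff in C as [C|C] |].
    + now apply Nat.eqb_eq in C.
    + now apply Nat.eqb_eq in C.
    + apply existsb_exists in C as [j [Hj E']]. apply Nat.eqb_eq in E'. now subst j.
Qed.

Lemma td_zero_outside : forall phi x, tight_difference phi -> 0 <= x < 1 ->
  ~ (l < x < u) -> ~ (f - u < x < f - l) -> phi x = 0.
Proof.
  intros phi x H Hx H17 H19. destruct (faces_cover x Hx) as [F [HF HFx]].
  destruct (In_nth face_list F no_face HF) as [i [Hi E]]. subst F.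
  change (length face_list) with 80%nat in Hi.
  refine (td_zero_on phi i H Hi _ _ x HFx); intros ->.
  - apply H17. rewrite <- posR_l, <- posR_u. exact HFx.
  - apply H19. change (in_face (iv 19) x) in HFx.
    apply (within_sound _ (ssub pos_f pos_u) (ssub pos_f pos_l)) in HFx;
      [| vm_compute; reflexivity].
    now rewrite !posR_sub, posR_l, posR_u, posR_f in HFx.
Qed.

(** The breakpoints [pt 6], [pt 10], [pt 13] are [f - (l + u - t)] for the three
    values of [t], and [pi] is additive on each of them with [iv 17] twice. *)
Lemma td_antisymmetric : forall phi x t, tight_difference phi ->
  t = 0 \/ t = t1 \/ t = t2 -> l < x < u -> l < l + u - t - x < u ->
  phi (l + u - t - x) = - phi x.
Proof.
  intros phi x t H Ht Hx Hy. unfold l, u in Hx, Hy.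
  assert (Hgen : forall i F, (i < 80)%nat -> i <> iv_no 17 -> i <> iv_no 19 ->
    nth i face_list no_face = F -> fopen F = false ->
    posR (flo F) = f - (l + u - t) ->
    additive F (iv 17) (iv 17) 0 = true -> phi (l + u - t - x) = - phi x).
  { intros i F Hi H17 H19 E HF Hp Ha.
    assert (Hin : in_face F (f - (l + u - t))) by (unfold in_face; now rewrite HF, Hp).
    assert (HF' : In F faces) by (rewrite <- E; now apply (nth_In face_list)).
    assert (Z := td_zero_on phi i H Hi H17 H19). rewrite E in Z.
    specialize (Z _ Hin).
    assert (E' : phi (f - (l + u - t)) + phi x + phi (l + u - t - x) = 0).
    { apply (td_faces phi F (iv 17) (iv 17) 0); auto; try solve_face.
      - solve_in_face.
      - unfold l, u. solve_in_face.
      - simpl. lra. }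
    lra. }
  destruct Ht as [->|[->| ->]].
  - apply (Hgen (pt_no 6) (pt 6)); unfold pt_no, iv_no; try lia; try reflexivity.
    + unfold posR, surdR, pos_den, f, l, u; simpl. lra.
  - apply (Hgen (pt_no 10) (pt 10)); unfold pt_no, iv_no; try lia; try reflexivity.
    + unfold posR, surdR, pos_den, f, l, u, t1; simpl. lra.
  - apply (Hgen (pt_no 13) (pt 13)); unfold pt_no, iv_no; try lia; try reflexivity.
    + unfold posR, surdR, pos_den, f, l, u, t2; simpl. lra.
Qed.

(** * The group [T] *)

Lemma T_add : forall x y, T x -> T y -> T (x + y).
Proof.
  intros x y [a [b ->]] [c [d ->]]. exists (a + c)%Z, (b + d)%Z.
  rewrite !plus_IZR. ring.
Qed.

Lemma T_mul : forall k x, T x -> T (IZR k * x).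
Proof.
  intros k x [a [b ->]]. exists (k * a)%Z, (k * b)%Z. rewrite !mult_IZR. ring.
Qed.

Lemma T_opp : forall x, T x -> T (- x).
Proof.
  intros x H. apply (T_mul (-1)) in H. now replace (- x) with (-1 * x) by ring.
Qed.

Lemma T_0 : T 0.
Proof. exists 0%Z, 0%Z. ring. Qed.

Lemma T_t1 : T t1.
Proof. exists 1%Z, 0%Z. ring. Qed.

Lemma T_t2 : T t2.
Proof. exists 0%Z, 1%Z. ring. Qed.

Lemma sqrt2_rough : 14 / 10 < sqrt 2 < 15 / 10.
Proof. assert (H := sqrt2_bounds). unfold root_lo, root_hi, root_den in H. lra. Qed.

(** Since [t1 = t2 * sqrt 2 / 3], the group contains the elements
    [t2 * (sqrt 2 - 1) ^ n], which tend to [0]. *)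
Lemma T_small : forall e, 0 < e -> exists t, T t /\ 0 < t < e.
Proof.
  intros e He. assert (Hs := sqrt2_rough).
  assert (Hpow : forall n, exists a b : Z, (sqrt 2 - 1) ^ n = IZR a + IZR b * sqrt 2).
  { induction n as [|n [a [b E]]].
    - exists 1%Z, 0%Z. simpl. ring.
    - exists (2 * b - a)%Z, (a - b)%Z. cbn [pow].
      rewrite E, !minus_IZR, mult_IZR.
      assert (Hsq : sqrt 2 * sqrt 2 = 2) by (apply sqrt_sqrt; lra).
      ring_simplify. replace (sqrt 2 ^ 2) with 2 by (simpl; lra). ring. }
  destruct (pow_lt_1_zero (sqrt 2 - 1)) with (y := e / t2) as [n Hn].
  - rewrite Rabs_right; lra.
  - apply Rdiv_lt_0_compat; [exact He | unfold t2; lra].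
  - specialize (Hn n ltac:(lia)).
    assert (Hp : 0 < (sqrt 2 - 1) ^ n) by (apply pow_lt; lra).
    rewrite Rabs_right in Hn by lra.
    exists ((sqrt 2 - 1) ^ n * t2). split; [| split].
    + destruct (Hpow n) as [a [b E]]. exists (3 * b)%Z, a.
      rewrite E, mult_IZR. unfold t1, t2. field.
    + unfold t2. lra.
    + apply Rlt_div_r; [unfold t2; lra | exact Hn].
Qed.

Lemma T_dense : forall x c d, c < d -> exists t, T t /\ c < x + t < d.
Proof.
  intros x c d Hcd. destruct (T_small (d - c)) as [t [Ht Ht']]; [lra |].
  exists (IZR (up ((c - x) / t)) * t). split; [now apply T_mul |].
  destruct (archimed ((c - x) / t)) as [H1 H2].
  assert (E : (c - x) / t * t = c - x) by (field; lra).
  split; nra.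
Qed.

Lemma t1_t2_bounds : 0 < t1 /\ 0 < t2 /\ t1 + t2 < u - l.
Proof. assert (H := sqrt2_rough). unfold t1, t2, u, l. lra. Qed.

(** Invariance under the generators, wherever both points lie in [(l, u)],
    extends to [T]: as [t1 + t2 < u - l], one can walk from [x] to [x + t] by
    steps [t1] and [t2] of the required signs without leaving [(l, u)]. *)
Lemma T_invariant : forall (A : Type) (h : R -> A),
  (forall t x, t = t1 \/ t = t2 -> l < x < u -> l < x + t < u -> h (x + t) = h x) ->
  forall x t, T t -> l < x < u -> l < x + t < u -> h (x + t) = h x.
Proof.
  intros A h Hstep x t [a [b ->]] Hx.
  destruct t1_t2_bounds as [B1 [B2 B3]].
  assert (Hup : forall t x, t = t1 \/ t = t2 -> l < x < u -> l < x + t < u ->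
    h (x + t) = h x) by exact Hstep.
  assert (Hdown : forall t x, t = t1 \/ t = t2 -> l < x < u -> l < x - t < u ->
    h (x - t) = h x).
  { intros t y Ht Hy Hyt. rewrite <- (Hstep t (y - t)); auto.
    - f_equal; ring.
    - replace (y - t + t) with y by ring. exact Hy. }
  remember (Z.abs_nat a + Z.abs_nat b)%nat as n eqn:Hn.
  revert a b x Hn Hx. induction n as [|n IH]; intros a b x Hn Hx Hxt.
  { replace a with 0%Z by lia. replace b with 0%Z by lia. f_equal. ring. }
  (* the first step, if it stays inside, reduces to a shorter walk *)
  assert (S1 : (0 < a)%Z -> x + t1 < u -> h (x + (IZR a * t1 + IZR b * t2)) = h x).
  { intros Ha H. rewrite <- (Hup t1 x) by (auto; lra).
    rewrite <- (IH (a - 1)%Z b (x + t1)); [| lia | lra |]; rewrite minus_IZR.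
    - f_equal; ring.
    - replace (x + t1 + ((IZR a - 1) * t1 + IZR b * t2))
        with (x + (IZR a * t1 + IZR b * t2)) by ring. exact Hxt. }
  assert (S2 : (a < 0)%Z -> l < x - t1 -> h (x + (IZR a * t1 + IZR b * t2)) = h x).
  { intros Ha H. rewrite <- (Hdown t1 x) by (auto; lra).
    rewrite <- (IH (a + 1)%Z b (x - t1)); [| lia | lra |]; rewrite plus_IZR.
    - f_equal; ring.
    - replace (x - t1 + ((IZR a + 1) * t1 + IZR b * t2))
        with (x + (IZR a * t1 + IZR b * t2)) by ring. exact Hxt. }
  assert (S3 : (0 < b)%Z -> x + t2 < u -> h (x + (IZR a * t1 + IZR b * t2)) = h x).
  { intros Ha H. rewrite <- (Hup t2 x) by (auto; lra).
    rewrite <- (IH a (b - 1)%Z (x + t2)); [| lia | lra |]; rewrite minus_IZR.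
    - f_equal; ring.
    - replace (x + t2 + (IZR a * t1 + (IZR b - 1) * t2))
        with (x + (IZR a * t1 + IZR b * t2)) by ring. exact Hxt. }
  assert (S4 : (b < 0)%Z -> l < x - t2 -> h (x + (IZR a * t1 + IZR b * t2)) = h x).
  { intros Ha H. rewrite <- (Hdown t2 x) by (auto; lra).
    rewrite <- (IH a (b + 1)%Z (x - t2)); [| lia | lra |]; rewrite plus_IZR.
    - f_equal; ring.
    - replace (x - t2 + (IZR a * t1 + (IZR b + 1) * t2))
        with (x + (IZR a * t1 + IZR b * t2)) by ring. exact Hxt. }
  assert (Hsign : forall (z : Z) t, 0 < t ->
    (z = 0)%Z \/ ((0 < z)%Z /\ t <= IZR z * t) \/ ((z < 0)%Z /\ IZR z * t <= - t)).
  { intros z t Ht. destruct (Z.lt_trichotomy z 0) as [H|[H|H]]; auto.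
    - right; right. split; [exact H |].
      assert (IZR z <= -1) by (apply IZR_le; lia). nra.
    - right; left. split; [exact H |].
      assert (1 <= IZR z) by (apply IZR_le; lia). nra. }
  destruct (Hsign a t1 B1) as [->|[[Ha Ha']|[Ha Ha']]].
  - destruct (Hsign b t2 B2) as [->|[[Hb Hb']|[Hb Hb']]]; [lia | |].
    + apply S3; [exact Hb | lra].
    + apply S4; [exact Hb | lra].
  - destruct (Rlt_le_dec (x + t1) u) as [H|H]; [now apply S1 |].
    destruct (Hsign b t2 B2) as [->|[[Hb Hb']|[Hb Hb']]]; [lra | lra |].
    apply S4; [exact Hb | lra].
  - destruct (Rlt_le_dec l (x - t1)) as [H|H]; [now apply S2 |].
    destruct (Hsign b t2 B2) as [->|[[Hb Hb']|[Hb Hb']]]; [lra | | lra].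
    apply S3; [exact Hb | lra].
Qed.

Lemma antisymmetric_T_invariant : forall p : R -> R,
  (forall x t, t = 0 \/ t = t1 \/ t = t2 -> l < x < u ->
     l < l + u - t - x < u -> p (l + u - t - x) = - p x) ->
  forall x t, T t -> l < x < u -> l < x + t < u -> p (x + t) = p x.
Proof.
  intros p Hp. apply T_invariant. intros t x Ht Hx Hxt.
  assert (E1 := Hp x t ltac:(tauto) Hx ltac:(lra)).
  assert (E2 := Hp (x + t) 0 ltac:(tauto) Hxt ltac:(lra)).
  replace (l + u - 0 - (x + t)) with (l + u - t - x) in E2 by ring. lra.
Qed.

(** * Valid functions that are tight wherever [pi] is *)

(** At [x0 = 5879 / 20000], with second summand [f - l] and third summand
    [4899 / 5000] approached from below, the limit of the three-term sum of
    [pi] is only [1 + s].  So a perturbation is at least [- s] near [x0] on the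
    right, hence on every class modulo [T]. *)
Lemma td_ge : forall g, valid g -> tight_difference (fun x => g x - pi x) ->
  forall x, l < x < u -> - s <= g x - pi x.
Proof.
  intros g Hg H x Hx. apply Rnot_lt_le. intros Hlt.
  set (d := - s - (g x - pi x)) in *.
  set (e := Rmin (d / 10) (1 / 1000)).
  assert (He : 0 < e) by (unfold e, d; apply Rmin_glb_lt; lra).
  assert (He1 : e <= d / 10) by apply Rmin_l.
  assert (He2 : e <= 1 / 1000) by apply Rmin_r.
  destruct (T_dense x (5879 / 20000) (5879 / 20000 + e)) as [t [Ht Hxt]]; [lra |].
  assert (Hb : l = 219 / 800 /\ u = 269 / 800) by auto.
  assert (E := antisymmetric_T_invariant (fun x => g x - pi x)
    (fun x t Ht => td_antisymmetric _ x t H Ht) x t Ht Hx ltac:(lra)). simpl in E.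
  set (y := x + t) in *.
  set (z := 9 / 5 - 421 / 800 - y).
  assert (Z1 := td_zero_outside _ (421 / 800) H ltac:(lra)
                  ltac:(lra) ltac:(unfold f; lra)). simpl in Z1.
  assert (Z2 := td_zero_outside _ z H ltac:(unfold z; lra)
                  ltac:(unfold z; lra) ltac:(unfold f, z; lra)). simpl in Z2.
  assert (T3 := three_term_of_valid g Hg y (421 / 800) z
                  ltac:(exists 1%Z; unfold z, f; lra)).
  assert (P1 : pi y = 51443 / 147680 + c2 * (y - 219 / 800)).
  { rewrite (pi_face (iv 17)); [| solve_face | solve_in_face].
    unfold face_fun; simpl. change 65%Z with s2. rewrite slopeR_s2.
    unfold posR, valR, surdR, pos_den, val_den, slope_den; simpl. lra. }
  assert (P2 : pi (421 / 800) = 1147 / 2080).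
  { rewrite (pi_face (pt 20)); [| solve_face | solve_in_face].
    unfold face_fun; simpl. unfold slopeR.
    unfold posR, valR, surdR, pos_den, val_den, slope_den; simpl. lra. }
  assert (P3 : pi z = 899 / 1000 + c3 * (z - 4101 / 5000)).
  { rewrite (pi_face (iv 38)); [| solve_face | unfold z; solve_in_face].
    unfold face_fun; simpl. change (-779935)%Z with s3. rewrite slopeR_s3.
    unfold posR, valR, surdR, pos_den, val_den, slope_den; simpl. lra. }
  unfold z, c2, c3 in *. unfold d, s in *. lra.
Qed.

(** The converse of validity and tightness of the perturbed functions: there are
    no other valid functions that are tight wherever [pi] is. *)
Theorem perturbed_of_tight : forall g, valid g ->
  (forall y, tight (perturbed (fun _ => 0)) y -> tight g y) ->
  exists p, perturbation p /\ forall x, g x = perturbed p x.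
Proof.
  intros g Hg Ht. assert (H := tight_difference_of_valid g Hg Ht).
  set (p := fun x => g x - pi x) in *.
  assert (Hanti : forall x, l < x < u -> p (l + u - 0 - x) = - p x).
  { intros x Hx. apply td_antisymmetric; auto. lra. }
  exists p. split.
  - intros x Hx. split.
    + apply Rabs_le. assert (E1 := td_ge g Hg H x Hx).
      assert (E2 := td_ge g Hg H (l + u - 0 - x) ltac:(lra)).
      fold (p x) in E1. fold (p (l + u - 0 - x)) in E2. rewrite Hanti in E2; lra.
    + intros t Ht' Hy. now apply td_antisymmetric.
  - intros x. unfold perturbed.
    assert (Hper : p x = p (frac_part x)).
    { assert (Hx := td_odd p H x (f - x) ltac:(exists 0%Z; simpl; lra)).
      destruct (frac_part_shift x) as [k Hk].
      assert (Hy := td_odd p H (frac_part x) (f - x) ltac:(exists k; lra)). lra. }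
    assert (E : extend p (frac_part x) = p (frac_part x)); [| unfold p in *; lra].
    set (y := frac_part x). assert (Hy := frac_part_unit x). fold y in Hy.
    destruct (classic (l < y < u)) as [H1|H1]; [now rewrite extend_lower |].
    destruct (classic (f - u < y < f - l)) as [H2|H2].
    + rewrite extend_upper by exact H2.
      assert (E := td_odd p H y (f - y) ltac:(exists 0%Z; simpl; lra)). lra.
    + rewrite extend_outside by assumption. symmetry. now apply td_zero_outside.
Qed.

(** * Cosets and the perturbation of [pi_hat] *)

Lemma coset_eq : forall x y, coset x = coset y <-> T (x - y).
Proof.
  intros x y. split.
  - intros E. change (coset y x). rewrite <- E. unfold coset.
    replace (x - x) with 0 by ring. apply T_0.
  - intros H. extensionality z. apply propositional_extensionality.
    unfold coset. split; intros Hz.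
    + replace (z - y) with (z - x + (x - y)) by ring. now apply T_add.
    + replace (z - x) with (z - y + - (x - y)) by ring. now apply T_add, T_opp.
Qed.

Lemma rho_coset_eq : forall x, rho_coset (coset x) = coset (rho x).
Proof.
  intros x. extensionality z. apply propositional_extensionality.
  unfold rho_coset, coset, rho. split.
  - intros [y [Hy ->]]. replace (l + u - y - (l + u - x)) with (- (y - x)) by ring.
    now apply T_opp.
  - intros H. exists (l + u - z). split; [| ring].
    replace (l + u - z - x) with (- (z - (l + u - x))) by ring. now apply T_opp.
Qed.

Lemma rho_involutive : forall x, rho (rho x) = x.
Proof. intros x. unfold rho. ring. Qed.

Lemma orbit_rho : forall x, orbit (coset (rho x)) = orbit (coset x).
Proof.
  intros x. extensionality z. apply propositional_extensionality.
  unfold orbit. rewrite !rho_coset_eq, rho_involutive. tauto.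
Qed.

(** The four fixed cosets are those of [(l + u + t) / 2] for [t] in [T],
    classified by the parities of the two coefficients of [t]. *)
Lemma fixed_coset_iff : forall x, fixed_coset (coset x) <-> T (2 * x - (l + u)).
Proof.
  intros x. unfold fixed_coset. split.
  - assert (Hgen : forall t, T t -> coset x = coset ((l + u - t) / 2) ->
              T (2 * x - (l + u))).
    { intros t Ht E. apply coset_eq, (T_mul 2) in E.
      replace (2 * x - (l + u)) with (2 * (x - (l + u - t) / 2) + - t) by field.
      now apply T_add, T_opp. }
    intros [E|[E|[E|E]]].
    + apply (Hgen 0); [apply T_0 |]. now rewrite Rminus_0_r.
    + now apply (Hgen t1); [apply T_t1 |].
    + now apply (Hgen t2); [apply T_t2 |].
    + now apply (Hgen (t1 + t2)); [apply T_add; [apply T_t1 | apply T_t2] |].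
  - intros [a [b E]]. rewrite !coset_eq.
    assert (Hpar : forall z : Z, exists c, z = (2 * c)%Z \/ z = (2 * c - 1)%Z).
    { intros z. destruct (Z.Even_or_Odd z) as [[c ->]|[c ->]].
      - exists c. now left.
      - exists (c + 1)%Z. right. lia. }
    destruct (Hpar a) as [c [->| ->]], (Hpar b) as [d [->| ->]];
      rewrite ?minus_IZR, ?mult_IZR in E.
    + left. exists c, d. lra.
    + right; right; left. exists c, d. lra.
    + right; left. exists c, d. lra.
    + right; right; right. exists c, d. lra.
Qed.

Lemma not_fixed_rho : forall x, fixed_coset (coset (rho x)) <-> fixed_coset (coset x).
Proof.
  intros x. rewrite !fixed_coset_iff. unfold rho.
  replace (2 * (l + u - x) - (l + u)) with (- (2 * x - (l + u))) by ring.
  split; intros H; apply T_opp in H; [| exact H]. now rewrite Ropp_involutive in H.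
Qed.

Lemma selected_iff : forall cp x, choice_function cp -> ~ fixed_coset (coset x) ->
  selected cp (coset x) <-> cp (orbit (coset x)) = coset x.
Proof.
  intros cp x Hcp Hx. split.
  - intros [O [HO E]]. rewrite E at 2. f_equal.
    assert (HOx := Hcp O HO). rewrite <- E in HOx.
    destruct HO as [y [Hy ->]]. destruct HOx as [E'|E'].
    + now rewrite E'.
    + rewrite rho_coset_eq in E'. now rewrite E', orbit_rho.
  - intros E. exists (orbit (coset x)). split; [| now symmetry].
    now exists x.
Qed.

(** The orbit of a class that is not fixed is shared with its mirror class, and the
    choice function selects exactly one of the two. *)
Lemma selected_rho : forall cp x, choice_function cp -> ~ fixed_coset (coset x) ->
  selected cp (coset (rho x)) <-> ~ selected cp (coset x).
Proof.
  intros cp x Hcp Hx.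
  assert (Hne : coset (rho x) <> coset x).
  { intros E. apply Hx. apply fixed_coset_iff. apply coset_eq, T_opp in E.
    unfold rho in E. now replace (2 * x - (l + u)) with (- (l + u - x - x)) by ring. }
  rewrite !selected_iff by (try rewrite not_fixed_rho; auto).
  rewrite orbit_rho.
  assert (HO := Hcp (orbit (coset x)) ltac:(now exists x)).
  destruct HO as [E|E]; rewrite ?rho_coset_eq in E; rewrite E.
  - split; [intros E'; now symmetry in E' | tauto].
  - split; [intros _ E'; now apply Hne | tauto].
Qed.

Definition hat_sign (cp : ((R -> Prop) -> Prop) -> R -> Prop) (x : R) : R :=
  if excluded_middle_informative (fixed_coset (coset x)) then 0
  else if excluded_middle_informative (selected cp (coset x)) then s
  else - s.

Lemma hat_sign_T : forall cp x t, T t -> hat_sign cp (x + t) = hat_sign cp x.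
Proof.
  intros cp x t Ht. unfold hat_sign.
  replace (coset (x + t)) with (coset x); [reflexivity |].
  apply coset_eq. replace (x - (x + t)) with (- t) by ring. now apply T_opp.
Qed.

Lemma hat_sign_rho : forall cp x, choice_function cp ->
  hat_sign cp (rho x) = - hat_sign cp x.
Proof.
  intros cp x Hcp. unfold hat_sign. assert (H := not_fixed_rho x).
  destruct (excluded_middle_informative (fixed_coset (coset x))) as [H1|H1].
  - destruct excluded_middle_informative; [ring | tauto].
  - destruct (excluded_middle_informative (fixed_coset (coset (rho x)))); [tauto |].
    assert (H' := selected_rho cp x Hcp H1).
    destruct (excluded_middle_informative (selected cp (coset x)));
      destruct (excluded_middle_informative (selected cp (coset (rho x))));
      solve [ring | tauto].
Qed.

Lemma hat_sign_perturbation : forall cp, choice_function cp ->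
  perturbation (hat_sign cp).
Proof.
  intros cp Hcp x Hx. split.
  - unfold hat_sign. assert (0 < s) by (unfold s; lra).
    repeat destruct excluded_middle_informative; apply Rabs_le; lra.
  - intros t Ht _. rewrite <- hat_sign_rho by exact Hcp. unfold rho.
    replace (l + u - t - x) with (l + u - x + - t) by ring.
    apply hat_sign_T, T_opp. destruct Ht as [->|[->| ->]];
      [apply T_0 | apply T_t1 | apply T_t2].
Qed.

Lemma pi_hat_perturbed : forall cp, pi_hat cp = perturbed (hat_sign cp).
Proof.
  intros cp. extensionality x. unfold pi_hat, pi_hat_unit, perturbed.
  rewrite <- (pi_frac_part x). set (y := frac_part x).
  assert (Hc : l = 219 / 800 /\ u = 269 / 800 /\ f = 4 / 5) by auto.
  destruct (classic (l < y < u)) as [H1|H1];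
    [| destruct (classic (f - u < y < f - l)) as [H2|H2]].
  - rewrite extend_lower by exact H1. unfold hat_sign.
    assert (Ef : special_fixed y <-> fixed_coset (coset y)).
    { unfold special_fixed. split; [intros [H|H]; [tauto | lra] | tauto]. }
    assert (Ep : special_plus cp y <-> selected cp (coset y)).
    { unfold special_plus. split; [intros [H|H]; [tauto | lra] | tauto]. }
    assert (Ei : in_special_intervals y) by now left.
    destruct (excluded_middle_informative (fixed_coset (coset y)));
      destruct (excluded_middle_informative (~ in_special_intervals y \/ special_fixed y));
      try tauto; [lra |].
    destruct (excluded_middle_informative (selected cp (coset y)));
      destruct (excluded_middle_informative (special_plus cp y)); tauto || lra.
  - rewrite extend_upper by exact H2. unfold hat_sign.
    assert (Ef : special_fixed y <-> fixed_coset (coset (f - y))).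
    { unfold special_fixed. split; [intros [H|H]; [lra | tauto] | tauto]. }
    assert (Ep : special_plus cp y <-> unselected cp (coset (f - y))).
    { unfold special_plus. split; [intros [H|H]; [lra | tauto] | tauto]. }
    unfold unselected in Ep.
    assert (Ei : in_special_intervals y) by now right.
    destruct (excluded_middle_informative (fixed_coset (coset (f - y))));
      destruct (excluded_middle_informative (~ in_special_intervals y \/ special_fixed y));
      try tauto; [lra |].
    destruct (excluded_middle_informative (selected cp (coset (f - y))));
      destruct (excluded_middle_informative (special_plus cp y)); tauto || lra.
  - rewrite extend_outside by assumption.
    destruct excluded_middle_informative as [H|H]; [lra |].
    exfalso. apply H. left. unfold in_special_intervals. tauto.
Qed.

(** If [a * t1 + b * t2 = t2 / 3] then [2 * a ^ 2 = (1 - 3 * b) ^ 2], which is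
    impossible modulo 3. *)
Lemma third_not_in_T : ~ T (t2 / 3).
Proof.
  intros [a [b E]].
  assert (E1 : IZR a * sqrt 2 = 1 - 3 * IZR b) by (unfold t1, t2 in E; lra).
  assert (Hsq : sqrt 2 * sqrt 2 = 2) by (apply sqrt_sqrt; lra).
  assert (E2 : 2 * (IZR a * IZR a) = (1 - 3 * IZR b) * (1 - 3 * IZR b)).
  { rewrite <- E1. transitivity (sqrt 2 * sqrt 2 * (IZR a * IZR a)); 
      [now rewrite Hsq | ring]. }
  assert (E3 : (2 * (a * a) = (1 - 3 * b) * (1 - 3 * b))%Z).
  { apply eq_IZR. rewrite !mult_IZR, !minus_IZR, !mult_IZR. exact E2. }
  assert (Hm : (a mod 3 = 0 \/ a mod 3 = 1 \/ a mod 3 = 2)%Z)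
    by (assert (H := Z.mod_pos_bound a 3); lia).
  assert (Ha := Z.div_mod a 3 ltac:(lia)).
  destruct Hm as [Hm|[Hm|Hm]]; rewrite Hm in Ha; nia.
Qed.

Lemma hat_sign_takes_both : forall cp, choice_function cp ->
  exists x y, l < x < u /\ l < y < u /\ hat_sign cp x = s /\ hat_sign cp y = - s.
Proof.
  intros cp Hcp. set (x := (l + u + t2 / 3) / 2).
  assert (Hx : l < x < u) by (unfold x, l, u, t2; lra).
  assert (Hr : l < rho x < u) by (unfold rho; lra).
  assert (Hn : ~ fixed_coset (coset x)).
  { rewrite fixed_coset_iff. unfold x.
    replace (2 * ((l + u + t2 / 3) / 2) - (l + u)) with (t2 / 3) by field.
    apply third_not_in_T. }
  assert (E := hat_sign_rho cp x Hcp).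
  assert (Es : hat_sign cp x = s \/ hat_sign cp x = - s).
  { unfold hat_sign. destruct excluded_middle_informative; [tauto |].
    destruct excluded_middle_informative; auto. }
  destruct Es as [Es|Es]; rewrite Es in E.
  - exists x, (rho x). auto.
  - exists (rho x), x. rewrite E. repeat split; auto; lra || tauto.
Qed.

Lemma hat_sign_dense : forall cp a b, choice_function cp -> a < b ->
  (exists x, a < x < b /\ hat_sign cp x = s) /\
  (exists y, a < y < b /\ hat_sign cp y = - s).
Proof.
  intros cp a b Hcp Hab.
  destruct (hat_sign_takes_both cp Hcp) as [x [y [_ [_ [Ex Ey]]]]].
  destruct (T_dense x a b Hab) as [t [Ht Hxt]].
  destruct (T_dense y a b Hab) as [t' [Ht' Hyt]].
  split; [exists (x + t) | exists (y + t')]; now rewrite hat_sign_T.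
Qed.

(** * The five properties *)

Lemma pi_hat_two_sided_discontinuous : forall cp,
  two_sided_discontinuous (pi_hat cp).
Proof.
  intros cp. rewrite pi_hat_perturbed.
  (* near [0] both one-sided limits of [pi] exceed [1 / 10], but [pi 0 = 0] *)
  assert (Hlim : forall F : (R -> Prop) -> Prop,
    filterlim (perturbed (hat_sign cp)) F (locally (perturbed (hat_sign cp) 0)) ->
    F (fun x => perturbed (hat_sign cp) x < 1 / 10)).
  { intros F H. apply (H (fun y => y < 1 / 10)). rewrite perturbed_0.
    exists (mkposreal (1 / 10) ltac:(lra)). intros y Hy.
    unfold ball in Hy; simpl in Hy. unfold AbsRing_ball, abs, minus, plus, opp in Hy.
    simpl in Hy. apply Rabs_lt_between in Hy. lra. }
  assert (Hball : forall (e : posreal) y, Rabs y < e -> ball 0 e y).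
  { intros e y Hy. unfold ball; simpl. unfold AbsRing_ball, abs, minus, plus, opp; simpl.
    now rewrite Ropp_0, Rplus_0_r. }
  split; intros H; apply Hlim in H; destruct H as [e He].
  - set (d := Rmin (e / 2) (1 / 100)).
    assert (Hd : 0 < d) by (unfold d; apply Rmin_glb_lt; [destruct e; simpl|]; lra).
    assert (Hd1 : d <= e / 2) by apply Rmin_l.
    assert (Hd2 : d <= 1 / 100) by apply Rmin_r.
    specialize (He (- d)).
    assert (Hb : ball 0 e (- d)).
    { apply Hball. rewrite Rabs_Ropp, Rabs_right by lra. lra. }
    specialize (He Hb ltac:(lra)).
    assert (Hfr : frac_part (- d) = 1 - d).
    { rewrite <- (frac_part_id (1 - d)) by lra.
      unfold frac_part. replace (1 - d) with (- d + IZR 1) by (simpl; lra).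
      rewrite <- (Int_part_spec (- d + IZR 1) (Int_part (- d) + 1)).
      - rewrite plus_IZR. ring.
      - assert (B := base_Int_part (- d)). rewrite plus_IZR. lra. }
    unfold perturbed in He. rewrite <- pi_frac_part, Hfr in He.
    rewrite extend_outside in He by (unfold l, u, f; lra).
    rewrite (pi_face (iv 39)) in He; [| solve_face | solve_in_face].
    unfold face_fun in He; simpl in He. change 419965%Z with s1 in He.
    rewrite slopeR_s1 in He. unfold posR, valR, surdR, pos_den, val_den, slope_den in He.
    simpl in He. unfold c1 in He. lra.
  - set (d := Rmin (e / 2) (1 / 100)).
    assert (Hd : 0 < d) by (unfold d; apply Rmin_glb_lt; [destruct e; simpl|]; lra).
    assert (Hd1 : d <= e / 2) by apply Rmin_l.
    assert (Hd2 : d <= 1 / 100) by apply Rmin_r.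
    specialize (He d).
    assert (Hb : ball 0 e d) by (apply Hball; rewrite Rabs_right by lra; lra).
    specialize (He Hb ltac:(lra)).
    unfold perturbed in He. rewrite frac_part_id in He by lra.
    rewrite extend_outside in He by (unfold l, u, f; lra).
    rewrite (pi_face (iv 0)) in He; [| solve_face | solve_in_face].
    unfold face_fun in He; simpl in He. change (-779935)%Z with s3 in He.
    rewrite slopeR_s3 in He. unfold posR, valR, surdR, pos_den, val_den, slope_den in He.
    simpl in He. unfold c3 in He. lra.
Qed.

(** On [(l, u)] the function [pi] is affine and [pi_hat - pi] takes both values [s]
    and [- s] on dense sets. *)
Lemma pi_hat_not_piecewise_linear : forall cp, choice_function cp ->
  ~ piecewise_linear (pi_hat cp).
Proof.
  intros cp Hcp [Pc [Hproper [_ [Hcover [_ Haff]]]]].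
  assert (Hc : l = 219 / 800 /\ u = 269 / 800) by auto.
  destruct (Hcover ((l + u) / 2)) as [[ra rb] [HI [Ha Hb]]].
  specialize (Hproper _ HI). destruct (Haff _ HI) as [m [q Hmq]].
  unfold proper in Hproper. simpl in Ha, Hb, Hproper.
  assert (Hsub : exists a b, a < b /\ l <= a /\ b <= u /\
    forall x, a < x < b -> in_interior (ra, rb) x).
  { exists (match ra with Finite a => Rmax a l | _ => l end),
           (match rb with Finite b => Rmin b u | _ => u end).
    unfold in_interior; simpl.
    destruct ra as [a| |]; destruct rb as [b| |]; simpl in *; try tauto.
    - assert (Rmax a l < Rmin b u) by (apply Rmax_lub_lt; apply Rmin_glb_lt; lra).
      assert (a <= Rmax a l) by apply Rmax_l. assert (l <= Rmax a l) by apply Rmax_r.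
      assert (Rmin b u <= b) by apply Rmin_l. assert (Rmin b u <= u) by apply Rmin_r.
      repeat split; lra.
    - assert (Rmax a l < u) by (apply Rmax_lub_lt; lra).
      assert (a <= Rmax a l) by apply Rmax_l. assert (l <= Rmax a l) by apply Rmax_r.
      repeat split; lra.
    - assert (l < Rmin b u) by (apply Rmin_glb_lt; lra).
      assert (Rmin b u <= b) by apply Rmin_l. assert (Rmin b u <= u) by apply Rmin_r.
      repeat split; lra.
    - repeat split; lra. }
  destruct Hsub as [a [b [Hab [Hal [Hbu Hin]]]]].
  (* an affine function cannot take the values [s], [- s], [s] in this order *)
  destruct (hat_sign_dense cp a b Hcp Hab) as [_ [y [Hy Ey]]].
  destruct (hat_sign_dense cp a y Hcp ltac:(lra)) as [[x [Hx Ex]] _].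
  destruct (hat_sign_dense cp y b Hcp ltac:(lra)) as [[z [Hz Ez]] _].
  assert (Hval : forall w, a < w < b ->
    m * w + q = 51443 / 147680 + c2 * (w - 219 / 800) + hat_sign cp w).
  { intros w Hw. rewrite <- Hmq by now apply Hin.
    rewrite pi_hat_perturbed. unfold perturbed. rewrite frac_part_id by lra.
    rewrite extend_lower by lra.
    rewrite (pi_face (iv 17)); [| solve_face | solve_in_face].
    unfold face_fun; simpl. change 65%Z with s2. rewrite slopeR_s2.
    unfold posR, valR, surdR, pos_den, val_den, slope_den; simpl. lra. }
  assert (Vx := Hval x ltac:(lra)). assert (Vy := Hval y ltac:(lra)).
  assert (Vz := Hval z ltac:(lra)). rewrite Ex in Vx. rewrite Ey in Vy.
  rewrite Ez in Vz. assert (Hs : 0 < s) by (unfold s; lra).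
  assert (D1 : (m - c2) * (y - x) = - 2 * s) by lra.
  assert (D2 : (m - c2) * (z - y) = 2 * s) by lra.
  nra.
Qed.

Lemma tight_of_average : forall g g1 g2, valid g1 -> valid g2 ->
  (forall x, g x = / 2 * (g1 x + g2 x)) ->
  forall y, tight g y -> tight g1 y.
Proof.
  intros g g1 g2 H1 H2 E. apply tight_on_lists. intros L HL Hg.
  apply valid_on_lists in H1 as [_ H1]. apply valid_on_lists in H2 as [_ H2].
  specialize (H1 L HL). specialize (H2 L HL).
  assert (Hsum : lsum (map g L) = / 2 * (lsum (map g1 L) + lsum (map g2 L))).
  { clear - E. unfold lsum. induction L as [|a L IH]; simpl; [lra |].
    rewrite IH, E. lra. }
  lra.
Qed.

Lemma perturbation_fixed : forall p x, perturbation p -> l < x < u ->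
  fixed_coset (coset x) -> p x = 0.
Proof.
  intros p x Hp Hx Hf. apply fixed_coset_iff, T_opp in Hf.
  assert (E1 := proj2 (Hp x Hx) 0 ltac:(tauto) ltac:(lra)).
  assert (E2 := antisymmetric_T_invariant p
    (fun x t Ht Hx => proj2 (Hp x Hx) t Ht) x _ Hf Hx ltac:(lra)).
  replace (x + - (2 * x - (l + u))) with (l + u - 0 - x) in E2 by ring. lra.
Qed.

Lemma extend_ext : forall p q, (forall x, l < x < u -> p x = q x) ->
  forall x, extend p x = extend q x.
Proof.
  intros p q H x. destruct (classic (l < x < u)) as [H1|H1].
  { rewrite !extend_lower by exact H1. auto. }
  destruct (classic (f - u < x < f - l)) as [H2|H2].
  { rewrite !extend_upper by exact H2. rewrite H; lra. }
  now rewrite !extend_outside.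
Qed.

(** Perturbations are bounded by [s], so [+ s] and [- s] are averages of two of
    them only in the trivial way; on fixed cosets every perturbation is [0]. *)
Lemma pi_hat_extreme : forall cp, choice_function cp -> extreme (pi_hat cp).
Proof.
  intros cp Hcp. rewrite pi_hat_perturbed.
  assert (Hp := hat_sign_perturbation cp Hcp).
  split; [now apply perturbed_valid |].
  assert (Hone : forall g1 g2, valid g1 -> valid g2 ->
    (forall x, perturbed (hat_sign cp) x = / 2 * (g1 x + g2 x)) ->
    exists p, perturbation p /\ forall x, g1 x = perturbed p x).
  { intros g1 g2 H1 H2 E. apply perturbed_of_tight; [exact H1 |].
    intros y Hy. apply (tight_of_average _ g1 g2 H1 H2 E).
    apply (perturbed_tight (fun _ => 0)); auto using perturbation_0. }
  intros g1 g2 H1 H2 E.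
  destruct (Hone g1 g2 H1 H2 E) as [p [Hpp Ep]].
  destruct (Hone g2 g1 H2 H1 ltac:(intros x; rewrite E; lra)) as [q [Hq Eq]].
  assert (Hc : l = 219 / 800 /\ u = 269 / 800) by auto.
  assert (Hpq : forall x, l < x < u -> hat_sign cp x = p x /\ hat_sign cp x = q x).
  { intros x Hx. assert (Ex := E x). rewrite Ep, Eq in Ex. unfold perturbed in Ex.
    rewrite frac_part_id in Ex by lra. rewrite !extend_lower in Ex by exact Hx.
    assert (B1 := proj1 (Hpp x Hx)). assert (B2 := proj1 (Hq x Hx)).
    apply Rabs_le_between in B1. apply Rabs_le_between in B2.
    unfold hat_sign in *.
    destruct excluded_middle_informative as [Hf|Hf].
    - now rewrite (perturbation_fixed p), (perturbation_fixed q).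
    - destruct excluded_middle_informative; lra. }
  split; intros x; rewrite ?Ep, ?Eq; unfold perturbed; f_equal;
    apply extend_ext; intros y Hy; now apply Hpq.
Qed.

(** A valid function that is tight wherever [pi_hat] is, is again a perturbation of
    [pi], and all perturbations have the same tight sets. *)
Lemma pi_hat_weak_facet : forall cp, choice_function cp -> weak_facet (pi_hat cp).
Proof.
  intros cp Hcp. rewrite pi_hat_perturbed.
  assert (Hp := hat_sign_perturbation cp Hcp).
  split; [now apply perturbed_valid |]. intros g Hg Ht y. split; [apply Ht |].
  destruct (perturbed_of_tight g Hg) as [p [Hpp Ep]].
  { intros w Hw. apply Ht.
    apply (perturbed_tight (fun _ => 0)); auto using perturbation_0. }
  assert (Eg : g = perturbed p) by (extensionality x; apply Ep).
  rewrite Eg. now apply perturbed_tight.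
Qed.

(** [pi] itself is tight wherever [pi_hat] is, and differs from it. *)
Lemma pi_hat_not_facet : forall cp, choice_function cp -> ~ facet (pi_hat cp).
Proof.
  intros cp Hcp [_ H]. rewrite pi_hat_perturbed in H.
  assert (Hp := hat_sign_perturbation cp Hcp).
  destruct (hat_sign_takes_both cp Hcp) as [x [_ [Hx [_ [Ex _]]]]].
  assert (Hc : l = 219 / 800 /\ u = 269 / 800 /\ s = 19 / 23998) by auto.
  specialize (H (perturbed (fun _ => 0)) (perturbed_valid _ perturbation_0)
    (perturbed_tight _ _ Hp perturbation_0) x).
  unfold perturbed in H. rewrite frac_part_id in H by lra.
  rewrite !extend_lower in H by exact Hx. lra.
Qed.

Theorem theorem6p3 :
  forall cp : ((R -> Prop) -> Prop) -> (R -> Prop),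
    choice_function cp ->
    two_sided_discontinuous (pi_hat cp) /\
    ~ piecewise_linear (pi_hat cp) /\
    extreme (pi_hat cp) /\
    weak_facet (pi_hat cp) /\
    ~ facet (pi_hat cp).
Proof.
  intros cp Hcp. split; [| split; [| split; [| split]]].
  - apply pi_hat_two_sided_discontinuous.
  - now apply pi_hat_not_piecewise_linear.
  - now apply pi_hat_extreme.
  - now apply pi_hat_weak_facet.
  - now apply pi_hat_not_facet.
Qed.
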